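(* Assume that $U$ is a compact subset of a Polish space $(\mathcal U,d_{\mathcal U})$ and that $f:\mathbb R^n\times U\to T\mathbb R^n$, $f(x,u)=(x,\hat f(x,u))$, is Lipschitz continuous, i.e. there is $L_f>0$ with $d_{T\mathbb R^n}(f(x,u_1),f(y,u_2))\le L_f(\|x-y\|_{\mathbb R^n}+d_{\mathcal U}(u_1,u_2))$ for all $x,y\in\mathbb R^n$, $u_1,u_2\in U$. Fix $\bar\mu\in\mathcal P_c(\mathbb R^n)$ and a compact set $K\subseteq\mathbb R^n$ with $\operatorname{spt}(\bar\mu)\subseteq K$. Let $(\tilde u_k)_{k\in\mathbb N}$ be a sequence of uniformly $\mathcal W$-Lipschitz continuous measure controls. For each $k$ let $\mu_k$ be a solution to $\dot\mu=V^{\tilde u_k}[\mu]$ with $\mu(0)=\bar\mu$ obtained as limit of Lattice Approximate Solutions (LAS), and assume that $\operatorname{spt}(\mu_k(t))\subseteq K$ for every $k\in\mathbb N$ and $t\ge0$. Suppose there exists a map $[0,+\infty)\ni t\mapsto\mu(t)\in\mathcal P(\mathbb R^n)$ such that $$\lim_{k\to+\infty}\ \sup_{t\ge0}W_{\mathbb R^n}(\mu_k(t),\mu(t))=0.$$ Then the map $t\mapsto\mu(t)$ is a solution to $\dot\mu=V[\mu]$, $\mu(0)=\bar\mu$, for some measure vector field $V$.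
   Context: $T\mathbb R^n$ is identified with $\mathbb R^n\times\mathbb R^n$ (pairs $(x,v)$, base point and velocity), with $d_{T\mathbb R^n}$ the Euclidean distance on $\mathbb R^{2n}$. For a Polish space $(X,d)$, $\mathcal P(X)$ is the set of Borel probability measures on $X$, $\mathcal P_c(X)$ the subset of those with compact support, $\operatorname{spt}$ denotes support, and $\phi_{\#}\mu$ is the pushforward. $\mathcal T(\mu_1,\mu_2)$ is the set of transference plans (couplings) of $\mu_1,\mu_2\in\mathcal P(X)$, $W_X(\mu_1,\mu_2)=\min_{\tau\in\mathcal T(\mu_1,\mu_2)}\int_{X\times X} d(x,y)\,d\tau(x,y)$ is the ($1$-)Wasserstein distance, and $\mathcal T^{opt}(\mu_1,\mu_2)$ is the set of plans attaining the minimum. A measure control is a map $\tilde u:\mathcal P(\mathbb R^n)\to\mathcal P(\mathbb R^n\times U)$ with $(\pi_1)_{\#}(\tilde u[\mu])=\mu$ for every $\mu\in\mathcal P(\mathbb R^n)$, where $\pi_1$ is the projection onto $\mathbb R^n$. Its associated measure vector field is $V^{\tilde u}:\mathcal P(\mathbb R^n)\to\mathcal P(T\mathbb R^n)$, $V^{\tilde u}[\mu]=f_{\#}(\tilde u[\mu])$. For $\nu_1,\nu_2\in\mathcal P(\mathbb R^n\times U)$ with first marginals $\mu_i=(\pi_1)_{\#}\nu_i$, define the Wasserstein pseudo-distance $$\mathcal W_{\mathbb R^n\times U}(\nu_1,\nu_2)=\inf\Big\{\int_{(\mathbb R^n\times U)^2} d_{\mathcal U}(u_1,u_2)\,dT(x,u_1,y,u_2):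 T\in\mathcal T(\nu_1,\nu_2),\ (\pi_{1,3})_{\#}T\in\mathcal T^{opt}(\mu_1,\mu_2)\Big\},$$ where $\pi_{1,3}(x,u_1,y,u_2)=(x,y)$ and optimality is with respect to $W_{\mathbb R^n}$. The sequence $(\tilde u_k)$ is uniformly $\mathcal W$-Lipschitz continuous if there is $C>0$ such that $\mathcal W_{\mathbb R^n\times U}(\tilde u_k[\mu],\tilde u_k[\nu])\le C\,W_{\mathbb R^n}(\mu,\nu)$ for every $k\in\mathbb N$ and $\mu,\nu\in\mathcal P_c(\mathbb R^n)$. A measure vector field is a map $V:\mathcal P(\mathbb R^n)\to\mathcal P(T\mathbb R^n)$ with $(\pi_1)_{\#}V[\mu]=\mu$ for all $\mu$. A solution to $\dot\mu=V[\mu]$, $\mu(0)=\bar\mu$, is a map $\mu:[0,+\infty)\to\mathcal P(\mathbb R^n)$ with $\mu(0)=\bar\mu$ such that, on every interval $[0,T]$ and for every $g\in C_c^\infty(\mathbb R^n)$: the integral $\int_{T\mathbb R^n}(\nabla g(x)\cdot v)\,dV[\mu(s)](x,v)$ is defined for a.e. $s\in[0,T]$; the map $s\mapsto\int_{T\mathbb R^n}(\nabla g(x)\cdot v)\,dV[\mu(s)](x,v)$ belongs to $L^1([0,T])$; and the map $t\mapsto\int_{\mathbb R^n} g\,d\mu(t)$ is absolutely continuous and satisfies $\frac{d}{dt}\int_{\mathbb R^n} g\,d\mu(t)=\int_{T\mathbb R^n}(\nabla g(x)\cdot v)\,dV[\mu(t)](x,v)$ for a.e. $t\in[0,T]$.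 Lattice Approximate Solutions. Let $N\in\mathbb N\setminus\{0\}$, let $x_i$ range over $\frac{\mathbb Z^n}{N^2}\cap[-N,N]^n$ and $v_j$ over $\frac{\mathbb Z^n}{N}\cap[-N,N]^n$, and put $Q=[0,\frac1{N^2})^n$, $Q'=[0,\frac1N)^n$. For a measure vector field $V$ and $\bar\mu\in\mathcal P_c(\mathbb R^n)$, the LAS $\mu^N$ is defined recursively by $\mu^N(0)=\sum_i\bar\mu(x_i+Q)\,\delta_{x_i}$ and, for $\ell=0,1,2,\dots$ and $t\in[\frac{\ell}{N},\frac{\ell+1}{N}]$, $$\mu^N(t)=\sum_i\sum_j m^v_{ij}\Big(V\big[\mu^N(\tfrac{\ell}{N})\big]\Big)\,\delta_{x_i+(t-\frac{\ell}{N})v_j},\qquad m^v_{ij}(V[\mu])=V[\mu]\big(\{(x_i,v):v\in v_j+Q'\}\big).$$ (On a given interval $[0,T]$, $N$ is taken large enough that the grids capture all the mass, so that $\mu^N(t)$ is a probability measure.) A solution $\mu$ of $\dot\mu=V[\mu]$, $\mu(0)=\bar\mu$ is obtained as limit of LAS if, for every $T>0$, $\lim_{N\to+\infty}\sup_{t\in[0,T]}W_{\mathbb R^n}(\mu^N(t),\mu(t))=0$. *)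

(* Defs.v *)
From HB Require Import structures.
From mathcomp Require Import all_boot all_order all_algebra.
From mathcomp Require Import all_classical all_reals all_analysis.
From mathcomp Require Export giry.

Set Implicit Arguments.
Unset Strict Implicit.
Unset Printing Implicit Defensive.

Import Order.TTheory GRing.Theory Num.Theory.
Import numFieldNormedType.Exports.

Local Open Scope classical_set_scope.
Local Open Scope ring_scope.

HB.instance Definition _ (T1 T2 : ptopologicalType) :=
  Pointed.on (T1 * T2)%type.

Notation borel T := (g_sigma_algebraType (@open T)).

(* Elements of [probability] are functions on all sets, whose values outside
   the sigma-algebra carry no information: equality in P(T) is [_ ≡μ _]. *)
Notation "''P[' R ] T" := (probability (borel T%type) R)
  (at level 9, T at level 9, format "''P[' R ]  T") : type_scope.

Section Polish.
Context {R : realType}.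

Definition complete_space (T : metricType R) :=
  forall F : set_system T, ProperFilter F -> cauchy F -> exists x : T, F --> x.

Definition separable_space (T : metricType R) :=
  exists2 D : set T, countable D & dense D.

Definition polish (T : metricType R) := complete_space T /\ separable_space T.

End Polish.

Section ControlSpace.
Context {R : realType} {T : metricType R}.

(* The subset U with its subspace topology. The point u0 is only there because
   measurable types are pointed; when U is empty, so is P(R^n x U). *)
Definition ctrl (U : set T) (u0 : U) : Type := U.

HB.instance Definition _ (U : set T) (u0 : U) :=
  PseudoMetric.copy (ctrl u0) (set_type U).
HB.instance Definition _ (U : set T) (u0 : U) := isPointed.Build (ctrl u0) u0.

Definition ctrl_val (U : set T) (u0 : U) (u : ctrl u0) : T := set_val u.

Definition ctrl_dist (U : set T) (u0 : U) (u1 u2 : ctrl u0) : R :=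
  mdist (ctrl_val u1) (ctrl_val u2).

End ControlSpace.

Section Pushforward.
Context {R : realType}.

Lemma continuous_measurable_borel (T1 T2 : ptopologicalType) (f : T1 -> T2) :
  continuous f -> measurable_fun [set: borel T1] (f : borel T1 -> borel T2).
Proof.
move=> /continuousP cf.
apply: (measurability (@open T2 : set (set (borel T2)))) => //.
move=> _ [B oB <-]; rewrite setTI; apply: sub_sigma_algebra; exact: cf.
Qed.

Section push.
Variables (T1 T2 : ptopologicalType) (f : T1 -> T2) (cf : continuous f).

Definition borel_mfun of continuous f : borel T1 -> borel T2 := f.

HB.instance Definition _ := @isMeasurableFun.Build _ _ _ _ (borel_mfun cf)
  (continuous_measurable_borel cf).

Definition push (mu : 'P[R] T1) : 'P[R] T2 := distribution mu (borel_mfun cf).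

End push.

Lemma fst_cont (T1 T2 : ptopologicalType) :
  continuous (fst : (T1 * T2)%type -> T1).
Proof. by move=> x; exact: cvg_fst. Qed.

Lemma snd_cont (T1 T2 : ptopologicalType) :
  continuous (snd : (T1 * T2)%type -> T2).
Proof. by move=> x; exact: cvg_snd. Qed.

Definition marginal1 (T1 T2 : ptopologicalType) (tau : 'P[R] (T1 * T2)) :
    'P[R] T1 :=
  @push (T1 * T2)%type T1 fst (@fst_cont T1 T2) tau.

Definition marginal2 (T1 T2 : ptopologicalType) (tau : 'P[R] (T1 * T2)) :
    'P[R] T2 :=
  @push (T1 * T2)%type T2 snd (@snd_cont T1 T2) tau.

Definition spt (T : ptopologicalType) (mu : 'P[R] T) : set T :=
  [set x | forall A, open A -> A x -> (0 < mu A)%E].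

Definition compactly_supported (T : ptopologicalType) (mu : 'P[R] T) :=
  compact (spt mu).

End Pushforward.

Section Wasserstein.
Context {R : realType}.
Local Open Scope ereal_scope.

Definition couplings (S T : ptopologicalType) (mu1 : 'P[R] S) (mu2 : 'P[R] T) :
    set ('P[R] (S * T)) :=
  [set tau | marginal1 tau ≡μ mu1 /\ marginal2 tau ≡μ mu2].

Definition transport_cost (S T : ptopologicalType) (d : S -> T -> R)
    (tau : 'P[R] (S * T)) : \bar R :=
  \int[tau]_z (d z.1 z.2)%:E.

(* Stated as an infimum; it is attained whenever T is Polish and d is its
   distance. *)
Definition wasserstein (T : ptopologicalType) (d : T -> T -> R)
    (mu1 mu2 : 'P[R] T) : \bar R :=
  ereal_inf [set transport_cost d tau | tau in couplings mu1 mu2].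

Definition opt_couplings (T : ptopologicalType) (d : T -> T -> R)
    (mu1 mu2 : 'P[R] T) : set ('P[R] (T * T)) :=
  [set tau | couplings mu1 mu2 tau
           /\ transport_cost d tau = wasserstein d mu1 mu2].

Definition proj13 (X Y : Type) (z : (X * Y) * (X * Y)) : X * X :=
  (z.1.1, z.2.1).

Lemma proj13_cont (X Y : ptopologicalType) : continuous (@proj13 X Y).
Proof.
move=> z; apply: cvg_pair => /=.
  by apply: (@cvg_comp _ _ _ fst fst); [exact: cvg_fst|exact: cvg_fst].
by apply: (@cvg_comp _ _ _ snd fst); [exact: cvg_snd|exact: cvg_fst].
Qed.

Definition marginal13 (X Y : ptopologicalType)
    (tau : 'P[R] ((X * Y) * (X * Y))) : 'P[R] (X * X) :=
  @push R ((X * Y) * (X * Y))%type (X * X)%type (@proj13 X Y)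
    (@proj13_cont X Y) tau.

Definition wasserstein_pseudo (X Y : ptopologicalType) (dX : X -> X -> R)
    (dY : Y -> Y -> R) (nu1 nu2 : 'P[R] (X * Y)) : \bar R :=
  ereal_inf [set transport_cost (fun z1 z2 => dY z1.2 z2.2) tau | tau in
    [set tau | couplings nu1 nu2 tau /\
       opt_couplings dX (marginal1 nu1) (marginal1 nu2)
         (marginal13 tau)]].

End Wasserstein.

Section EuclideanSpace.
Context {R : realType} {n : nat}.
Local Notation X := 'rV[R]_n.

Definition dotp (u v : X) : R := \sum_i u ord0 i * v ord0 i.

Definition eucl_norm (u : X) : R := Num.sqrt (dotp u u).

Definition eucl_dist (x y : X) : R := eucl_norm (x - y).

Lemma coord_le_eucl_norm (u : X) i : `|u ord0 i| <= eucl_norm u.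
Proof.
rewrite -sqrtr_sqr ler_wsqrtr// expr2 /dotp (bigD1 i)//= lerDl.
by apply: sumr_ge0 => j _; rewrite -expr2 sqr_ge0.
Qed.

Lemma mx_norm_le_eucl_norm (u : X) : `|u| <= eucl_norm u.
Proof.
rewrite [leLHS]mx_normrE; apply: bigmax_le; first exact: sqrtr_ge0.
by move=> [i j] _ /=; rewrite ord1 coord_le_eucl_norm.
Qed.

Lemma eucl_norm_le_mx_norm (u : X) : eucl_norm u <= n%:R * `|u|.
Proof.
have u0 : 0 <= n%:R * `|u| by rewrite mulr_ge0.
rewrite -(ger0_norm u0) -sqrtr_sqr ler_wsqrtr// /dotp.
apply: (@le_trans _ _ (\sum_(i < n) `|u| ^+ 2)).
  apply: ler_sum => i _; rewrite -expr2 -real_normK ?num_real//.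
  rewrite lerXn2r ?nnegrE// [leRHS]mx_normrE.
  exact: (le_bigmax _ (fun ij : 'I_1 * 'I_n => `|u ij.1 ij.2|) (ord0, i)).
rewrite sumr_const card_ord exprMn -[leLHS]mulr_natl ler_wpM2r ?sqr_ge0//.
by rewrite -natrX ler_nat; case: (n) => // k; rewrite expnS expn1 leq_pmulr.
Qed.

Definition tangent_dist (p q : X * X) : R :=
  Num.sqrt (eucl_dist p.1 q.1 ^+ 2 + eucl_dist p.2 q.2 ^+ 2).

Definition W1 : 'P[R] X -> 'P[R] X -> \bar R := wasserstein eucl_dist.

Definition partial (i : 'I_n) (g : X -> R) : X -> R :=
  'D_(delta_mx ord0 i : X) g.

Definition gradient (g : X -> R) (x : X) : X := \row_i partial i g x.

Fixpoint Ck (k : nat) (g : X -> R) : Prop :=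
  if k is k'.+1 then
    forall i : 'I_n,
      (forall x, derivable g x (delta_mx ord0 i : X)) /\ Ck k' (partial i g)
  else continuous g.

Definition smooth (g : X -> R) := forall k, Ck k g.

Definition test_function (g : X -> R) :=
  smooth g /\ compact (closure [set x | g x != 0]).

End EuclideanSpace.

Section AbsoluteContinuity.
Context {R : realType}.

Definition abs_continuous_on (a b : R) (F : R -> R) :=
  forall eps : R, 0 < eps -> exists2 delta : R, 0 < delta &
    forall (m : nat) (s t : 'I_m -> R),
      (forall i, a <= s i /\ s i <= t i /\ t i <= b) ->
      (forall i j, i != j -> `]s i, t i[ `&` `]s j, t j[ = set0) ->
      \sum_i (t i - s i) < delta ->
      \sum_i `|F (t i) - F (s i)| < eps.

(* L^1 consists of Lebesgue-a.e. classes, whence the representative h. *)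
Definition L1_on (a b : R) (F : R -> R) :=
  exists2 h : R -> R,
    (lebesgue_measure : set R -> \bar R).-integrable `[a, b] (EFin \o h) &
    {ae (lebesgue_measure : set R -> \bar R),
      forall s, s \in `[a, b] -> F s = h s}.

End AbsoluteContinuity.

Section MeasureDynamics.
Context {R : realType} {n : nat}.
Local Notation X := 'rV[R]_n.
Local Notation TX := (X * X)%type.

Definition measure_vector_field (V : 'P[R] X -> 'P[R] TX) :=
  (forall mu nu : 'P[R] X, mu ≡μ nu -> V mu ≡μ V nu) /\
  (forall mu, marginal1 (V mu) ≡μ mu).

Definition transport_integrand (g : X -> R) (z : TX) : R :=
  dotp (gradient g z.1) z.2.

(* Curves [0, +oo) -> P(X) are given as functions on R; only their values at
   nonnegative times are ever used. *)
Definition solution (V : 'P[R] X -> 'P[R] TX) (mubar : 'P[R] X)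
    (mu : R -> 'P[R] X) :=
  mu 0 ≡μ mubar /\
  forall T : R, 0 < T -> forall g : X -> R, test_function g ->
    let G s := \int[V (mu s)]_z transport_integrand g z in
    let F t := \int[mu t]_x g x in
    [/\ {ae (lebesgue_measure : set R -> \bar R), forall s, s \in `[0, T] ->
          (V (mu s)).-integrable setT (EFin \o transport_integrand g)},
        L1_on 0 T G,
        abs_continuous_on 0 T F &
        {ae (lebesgue_measure : set R -> \bar R), forall t, t \in `[0, T] ->
          is_derive t 1 F (G t)}].

Section LatticeApproximateSolutions.

(* (Z^n / M) \cap [-N, N]^n *)
Definition lattice (M N : nat) : set X :=
  [set x | forall c, (exists z : int, x ord0 c = z%:~R / M%:R) /\
                     - N%:R <= x ord0 c <= N%:R].

(* x + [0, r)^n *)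
Definition cube (x : X) (r : R) : set X :=
  [set y | forall c, x ord0 c <= y ord0 c < x ord0 c + r].

Definition LAS_space_grid (N : nat) := lattice (N ^ 2)%N N.

Definition LAS_velocity_grid (N : nat) := lattice N N.

Definition LAS_initial (N : nat) (mubar : 'P[R] X) (A : set (borel X)) :
    \bar R :=
  (\sum_(x \in LAS_space_grid N)
     mubar (cube x (N%:R ^- 2)) * \d_(x : borel X) A)%E.

(* m^v_{ij}(P), for x = x_i and v = v_j *)
Definition LAS_mass (N : nat) (P : 'P[R] TX) (x v : X) : \bar R :=
  P [set z | z.1 = x /\ cube v N%:R^-1 z.2].

Definition LAS_step (N : nat) (P : 'P[R] TX) (dt : R) (A : set (borel X)) :
    \bar R :=
  (\sum_(x \in LAS_space_grid N) \sum_(v \in LAS_velocity_grid N)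
     LAS_mass N P x v * \d_((x + dt *: v)%R : borel X) A)%E.

(* m is the lattice approximate solution of order N on [0, T]. Since m takes
   values in P(X), such an m exists only when N is so large that the grids
   capture all the mass up to time T. *)
Definition is_LAS (V : 'P[R] X -> 'P[R] TX) (mubar : 'P[R] X) (N : nat) (T : R)
    (m : R -> 'P[R] X) :=
  (forall A, measurable A -> m 0 A = LAS_initial N mubar A) /\
  (forall (l : nat) (t : R),
    l%:R / N%:R <= t <= l.+1%:R / N%:R -> t <= T ->
    forall A, measurable A ->
      m t A = LAS_step N (V (m (l%:R / N%:R))) (t - l%:R / N%:R) A).

Definition limit_of_LAS (V : 'P[R] X -> 'P[R] TX) (mubar : 'P[R] X)
    (mu : R -> 'P[R] X) :=
  forall T : R, 0 < T -> exists m : nat -> R -> 'P[R] X,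
    (\forall N \near \oo, is_LAS V mubar N T (m N)) /\
    ereal_sup [set W1 (m N t) (mu t) | t in `[0, T]] @[N --> \oo] --> 0%E.

End LatticeApproximateSolutions.
End MeasureDynamics.

Section Controls.
Context {R : realType} {n : nat} {Y : metricType R} {U : set Y} {u0 : U}.
Local Notation X := 'rV[R]_n.
Local Notation C := (ctrl u0).

Definition measure_control (u : 'P[R] X -> 'P[R] (X * C)) :=
  (forall mu nu : 'P[R] X, mu ≡μ nu -> u mu ≡μ u nu) /\
  (forall mu, marginal1 (u mu) ≡μ mu).

Definition uniformly_W_Lipschitz (u : nat -> 'P[R] X -> 'P[R] (X * C)) :=
  exists2 L : R, 0 < L & forall k mu nu,
    compactly_supported mu -> compactly_supported nu ->
    (wasserstein_pseudo eucl_dist (@ctrl_dist R Y U u0) (u k mu) (u k nu)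
       <= L%:E * W1 mu nu)%E.

Definition dynamics (fhat : X * C -> X) (z : X * C) : X * X :=
  (z.1, fhat z).

Definition dynamics_Lipschitz (fhat : X * C -> X) :=
  exists2 L : R, 0 < L & forall x y u1 u2,
    tangent_dist (dynamics fhat (x, u1)) (dynamics fhat (y, u2))
      <= L * (eucl_dist x y + ctrl_dist u1 u2).

Lemma dynamics_continuous (fhat : X * C -> X) :
  dynamics_Lipschitz fhat -> continuous (dynamics fhat).
Proof.
move=> [L L0 hf] p.
have cfhat : fhat q @[q --> p] --> fhat p.
  case: p => x u; apply/cvgrPdist_lt => e e0.
  have d0 : 0 < e / (L * (n%:R + 1)) by rewrite divr_gt0// mulr_gt0.
  apply/(@nbhs_ballP R (X * C)%type).
  exists (e / (L * (n%:R + 1))) => //= -[y w] [/= xy uw].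
  apply: (le_lt_trans (mx_norm_le_eucl_norm _)).
  apply: (@le_lt_trans _ _ (L * (eucl_dist x y + ctrl_dist u w))).
    apply: le_trans (hf x y u w); rewrite -[leLHS]ger0_norm ?sqrtr_ge0//.
    by rewrite -sqrtr_sqr ler_wsqrtr// lerDr sqr_ge0.
  rewrite mulrC -ltr_pdivlMr// -[ltRHS]mulr1.
  have -> : e / L * 1 = n%:R * (e / (L * (n%:R + 1))) + e / (L * (n%:R + 1)).
    rewrite -[X in _ = _ + X]mul1r -mulrDl mulrC mulrA.
    rewrite invfM mulrA [RHS]mulrC mulrA divfK ?mul1r//; exact: mulrC.
  apply: ler_ltD.
    apply: (le_trans (eucl_norm_le_mx_norm _)).
    rewrite ler_wpM2l// ltW//.
    by move: xy; rewrite -ball_normE.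
  have : ball (ctrl_val u) (e / (L * (n%:R + 1))) (ctrl_val w) by exact: uw.
  by rewrite ballEmdist.
have cf1 : q.1 @[q --> p] --> p.1 by exact: cvg_fst.
exact: (cvg_pair cf1 cfhat).
Qed.

Definition control_field (fhat : X * C -> X) (hf : dynamics_Lipschitz fhat)
    (u : 'P[R] X -> 'P[R] (X * C)) (mu : 'P[R] X) : 'P[R] (X * X) :=
  push (dynamics_continuous hf) (u mu).

End Controls.

(* Main.v *)
Require Import Defs.
From HB Require Import structures.
From mathcomp Require Import all_boot all_order all_algebra.
From mathcomp Require Import all_classical all_reals all_analysis.
From mathcomp Require Import measurable_realfun ring lra zify.

(** The statement asks for some vector field V, with no regularity, so V may be
    chosen separately at each measure, and only the values of V at the measures
    mu t matter. Moreover a solution only sees the integrals of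
    (grad g (x) . v) against V (mu t), which are linear in v: it is enough to
    produce a measure carried by a graph, V m = (id, b_m)_# m, for a suitable
    barycentric velocity b_m. Fix an ultrafilter F on the indices k finer than
    the filter of neighbourhoods of infinity. For m carried by K the set functions
    A |-> lim_F (integral over A x U of fhat_i d(u_k m)) are additive and
    dominated by a multiple of m, hence are charges with densities, and these
    densities are the coordinates of b_m ([setwise_barycenter],
    [barycentric_field]). By construction the integral of grad g . v against
    V m is the limit along F of the mean fluxes
    H_k m = integral of grad g (x) . fhat (x, w) d(u_k m)(x, w).

    It remains to see that t |-> integral of g d(mu t) has derivative
    G t = lim_F H_k (mu t). The Lipschitz condition on the controls and the
    uniform continuity of the flux give a modulus of continuity of H_k for W1
    which is the same for all k ([mean_flux_modulus]). It yields
    - H_k (mu_k t) - H_k (mu t) -> 0, uniformly in t;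
    - equicontinuity in k of t |-> H_k (mu t) on compact time intervals
      ([mean_flux_equicontinuous]). This is where the lattice approximations
      enter. The measure mu t is W1-close to mu_j t for one large j, which is
      W1-close to a lattice approximation m_N t, and within a time step m_N
      moves finitely many atoms at bounded speed, so that an explicit coupling
      bounds W1 (m_N s) (m_N t) ([LAS_step_W1]). The estimates on H_k, not the
      distances, are chained.

    So on a short interval around t the derivative H_k (mu_k s) of
    s |-> integral of g d(mu_k s) is within e of the constant H_k (mu t). These
    curves are absolutely continuous with this derivative almost everywhere,
    so their increments are within e (b - a) of H_k (mu t) (b - a)
    ([abs_continuous_slope]). The inequality passes to the limit along F and
    says that t |-> integral of g d(mu t) is differentiable with derivative
    G t at every t > 0 ([limit_curve_derivative]). The flux being bounded, this
    curve is Lipschitz; G is continuous by equicontinuity. *)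

Import Order.TTheory GRing.Theory Num.Theory.
Import numFieldNormedType.Exports.
Set Implicit Arguments.
Unset Strict Implicit.
Unset Printing Implicit Defensive.
Local Open Scope classical_set_scope.
Local Open Scope ring_scope.

(** * Mean value inequality for absolutely continuous functions *)

Section Slopes.
Context {R : realType}.
Implicit Types (F : R -> R) (t c d e : R).

Lemma is_deriveP F t d : is_derive t 1 F d <->
  (forall e, 0 < e -> exists2 r, 0 < r & forall y, `|y - t| < r ->
     `|F y - F t - d * (y - t)| <= e * `|y - t|).
Proof.
split.
- move=> [dF <-] e e0.
  have /cvgrPdist_le/(_ e e0) : (fun h => h^-1 *: ((F \o shift t) (h *: 1) - F t))
      @ 0^' --> 'D_1 F t by exact: dF.
  move=> [r /= r0 H]; exists r => // y yr.
  have [->|yt] := eqVneq y t; first by rewrite !subrr mulr0 subrr !normr0 mulr0.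
  have yt0 : y - t != 0 by rewrite subr_eq0.
  have := H (y - t); rewrite /= /ball_/= sub0r normrN => /(_ yr yt0).
  rewrite /GRing.scale/= mulr1 subrK => H1.
  have -> : F y - F t - 'D_1 F t * (y - t) =
    - (y - t) * ('D_1 F t - (y - t)^-1 * (F y - F t)) by field.
  by rewrite normrM normrN mulrC ler_wpM2r.
- move=> H.
  have cv : (fun h => h^-1 *: ((F \o shift t) (h *: 1) - F t)) @ 0^' --> d.
    apply/cvgrPdist_le => e e0.
    have [r r0 Hr] := H e e0.
    exists r => //= h; rewrite /ball_/= sub0r normrN => hr h0.
    rewrite /GRing.scale/= mulr1.
    have := Hr (h + t); rewrite addrK => /(_ hr) H1.
    rewrite -(ler_pM2r (_ : 0 < `|h|)) ?normr_gt0// -normrM.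
    apply: le_trans H1; rewrite -normrN.
    by rewrite le_eqVlt; apply/orP; left; apply/eqP; congr `|_|; field.
  by split; [apply/cvg_ex; exists d|apply: cvg_lim].
Qed.

End Slopes.

Section NullDerivative.
Context {R : realType}.
Implicit Types (F : R -> R) (O : set R).

(** The intervals are listed from right to left, so that a list grows at its head
    when x moves to the right, as it does in [chain_increment_bound]. *)
Fixpoint interval_chain O (a x : R) (l : seq (R * R)) : Prop :=
  if l is p :: l' then
    [/\ p.1 <= p.2, p.2 <= x, `]p.1, p.2[ `<=` O & interval_chain O a p.1 l']
  else a <= x.

Lemma interval_chain_widen O a x y l :
  interval_chain O a x l -> x <= y -> interval_chain O a y l.
Proof.
case: l => [|p l] /= => [ax xy|[p12 px pO pl] xy]; first exact: le_trans xy.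
by split => //; exact: le_trans xy.
Qed.

Lemma interval_chain_le O a x l : interval_chain O a x l -> a <= x.
Proof.
elim: l x => [//|p l IH] x /= [p12 px _ /IH ap].
by rewrite (le_trans ap)// (le_trans p12).
Qed.

Lemma interval_chain_nth O a x l i : interval_chain O a x l ->
  (i < size l)%N -> let p := nth (0, 0) l i in
  [/\ a <= p.1, p.1 <= p.2, p.2 <= x & `]p.1, p.2[ `<=` O].
Proof.
elim: l x i => [//|p l IH] x [|i] /= [p12 px pO pl].
  by move=> _; split => //; exact: interval_chain_le pl.
move=> il; have [? ? q2 ?] := IH _ _ pl il.
by split => //; rewrite (le_trans q2)// (le_trans p12).
Qed.

Lemma interval_chain_disj O a x l i j : interval_chain O a x l ->
  (i < j)%N -> (j < size l)%N -> (nth (0, 0) l j).2 <= (nth (0, 0) l i).1.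
Proof.
elim: l x i j => [//|p l IH] x [|i] [|j] //= [p12 px pO pl].
  by move=> _ jl; have [] := interval_chain_nth pl jl.
rewrite !ltnS => ij jl; exact: IH pl ij jl.
Qed.

Lemma interval_chain_length O a x l : open O -> interval_chain O a x l ->
  ((\sum_(p <- l) (p.2 - p.1))%:E <= (@lebesgue_measure R) (O `&` `]-oo, x[))%E.
Proof.
move=> oO; elim: l x => [|p l IH] x /=; first by rewrite big_nil measure_ge0.
move=> [p12 px pO /IH {}IH]; rewrite big_cons EFinD.
have mO : measurable O by exact: open_measurable.
apply: (@le_trans _ _ ((@lebesgue_measure R) (`]p.1, p.2[ `|` (O `&` `]-oo, p.1[)))).
  rewrite measureU//=; last 2 first.
  - by apply: measurableI.
  - apply/seteqP; split => // y [/=]; rewrite !in_itv/= => /andP[p1y _] [_].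
    by rewrite ltNge ltW.
  rewrite leeD// lebesgue_measure_itv/= lte_fin.
  by case: ltP => [_|p21]; rewrite ?EFinB// lee_fin subr_le0.
apply: le_measure; rewrite ?inE.
- by apply: measurableU => //; apply: measurableI.
- by apply: measurableI.
- move=> y [/=|[Oy]]; rewrite ?in_itv/=.
    move=> y12; split; first exact: pO.
    by move: y12; rewrite ?in_itv/= => /andP[_ y2]; exact: lt_le_trans px.
  by move=> yp; split => //; rewrite ?in_itv/= (lt_le_trans yp)// (le_trans p12).
Qed.

(** The increment of F over [a, b] is almost c (b - a) as soon as each point of
    [a, b] either lies in O or has a neighbourhood on which F has slope c up to
    e. Real induction on the right end point: a step around a point of the
    second kind costs e times its length, a step around a point of O is
    recorded in the chain. *)
Lemma chain_increment_bound F O (c e a b : R) : 0 <= e -> a <= b -> open O ->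
  (forall t, a <= t <= b -> O t \/ exists2 r, 0 < r & forall y, `|y - t| < r ->
     `|F y - F t - c * (y - t)| <= e * `|y - t|) ->
  exists2 l, interval_chain O a b l &
   `|F b - F a - c * (b - a)| <=
      e * (b - a) + \sum_(p <- l) `|F p.2 - F p.1 - c * (p.2 - p.1)|.
Proof.
move=> e0 ab oO Ht.
pose D (x : R) := exists2 l, interval_chain O a x l &
   `|F x - F a - c * (x - a)| <=
      e * (x - a) + \sum_(p <- l) `|F p.2 - F p.1 - c * (p.2 - p.1)|.
pose S := [set x | a <= x <= b /\ D x].
have Sa : S a.
  split; first by rewrite lexx.
  by exists [::] => //=; rewrite big_nil !subrr !mulr0 subrr normr0 addr0.
have Sb : has_sup S.
  by split; [exists a|exists b => x [/andP[]]].
have as_ : a <= sup S by apply: sup_upper_bound.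
have sb : sup S <= b by apply: ge_sup; [exists a|move=> x [/andP[]]].
(* Points where the bound holds accumulate at the supremum from the left, so
   one step straddling the supremum goes beyond it. *)
have step r : 0 < r -> exists2 x, S x & sup S - r < x /\ x <= sup S.
  move=> r0; have [x Sx xr] := sup_adherent r0 Sb; exists x => //; split => //.
  exact: sup_upper_bound.
have ext : exists2 r, 0 < r & forall y, sup S <= y < sup S + r -> D y.
  have := Ht (sup S); rewrite as_ sb => /(_ isT) [Os|[r r0 Hr]].
    have [r /= r0 rO] : nbhs (sup S) O by exact: open_nbhs_nbhs.
    exists r => // y /andP[sy yr].
    have [x [/andP[ax _] [l xl Hx]] [xs sx]] := step _ r0.
    exists ((x, y) :: l) => /=.
      split => //; first exact: le_trans sy.
      move=> z /=; rewrite in_itv/= => /andP[xz zy]; apply: rO => /=.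
      by rewrite /ball_/= distrC ltr_distl; apply/andP; split; lra.
    rewrite big_cons/=.
    have -> : F y - F a - c * (y - a) =
      (F y - F x - c * (y - x)) + (F x - F a - c * (x - a)) by ring.
    rewrite (le_trans (ler_normD _ _))// addrCA lerD// (le_trans Hx)// lerD//.
    by rewrite ler_wpM2l//; lra.
  exists r => // y /andP[sy yr].
  have [x [/andP[ax _] [l xl Hx]] [xs sx]] := step _ r0.
  have xy : x <= y by exact: le_trans sy.
  exists l; first exact: interval_chain_widen xl xy.
  have -> : F y - F a - c * (y - a) = (F y - F (sup S) - c * (y - sup S)) -
    (F x - F (sup S) - c * (x - sup S)) + (F x - F a - c * (x - a)) by ring.
  have -> : e * (y - a) = e * (y - sup S) + e * (sup S - x) + e * (x - a) by ring.
  rewrite (le_trans (ler_normD _ _))// -[leRHS]addrA lerD//.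
  rewrite (le_trans (ler_normB _ _))// lerD//.
    have := Hr y; rewrite (ger0_norm (_ : 0 <= y - sup S)) ?subr_ge0//.
    by apply; lra.
  have := Hr x; rewrite (ler0_norm (_ : x - sup S <= 0)) ?subr_le0// opprB.
  by apply; lra.
have [r r0 Hr] := ext.
have [sb'|bs] := ltP (sup S) b; last first.
  have -> : b = sup S by apply/eqP; rewrite eq_le bs sb.
  by apply: Hr; rewrite lexx/= ltrDl.
have /(sup_upper_bound Sb) : S (Num.min b (sup S + r / 2)).
  have [bs|bs] := leP b (sup S + r / 2).
    by split; [rewrite ab lexx|apply: Hr; rewrite sb/=; lra].
  split; first by rewrite ?(ltW bs) andbT; lra.
  by apply: Hr; apply/andP; split; lra.
rewrite ge_min => /orP[|]; lra.
Qed.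

(** The mean value inequality for an absolutely continuous F. Cover the null
    set where the derivative is not G by an open set O of small measure. The
    chain of [chain_increment_bound] lies in O, so its total length is small,
    and absolute continuity makes the total increment of F along it small. *)
Lemma abs_continuous_slope F (G : R -> R) (T c e a b : R) :
  abs_continuous_on 0 T F ->
  {ae (lebesgue_measure : set R -> \bar R), forall t, t \in `[0, T] ->
          is_derive t 1 F (G t)} ->
  0 <= a -> a <= b -> b <= T -> (forall t, a <= t <= b -> `|G t - c| <= e) ->
  `|F b - F a - c * (b - a)| <= e * (b - a).
Proof.
move=> FAC [N [mN N0 HN]] a0 ab bT HG.
have e0 : 0 <= e by apply: le_trans (HG a _); rewrite ?lexx.
apply/ler_addgt0Pr => e1 e10.
(* e1 pays for the slopes, e2 (b - a), for the increments of F along the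
   chain, e2, and for the increments of c t along the chain, |c| e2. *)
pose k := (b - a) + 1 + `|c|.
have k0 : 0 < k by rewrite /k; have := normr_ge0 c; lra.
pose e2 := e1 / k.
have e20 : 0 < e2 by rewrite divr_gt0.
have [d d0 Hd] := FAC e2 e20.
have md0 : 0 < Num.min d e2 by rewrite lt_min d0.
have [|O [oO NO mO]] := lebesgue_regularity_outer mN _ md0.
  by rewrite [ltLHS]N0.
have {}mO : ((@lebesgue_measure R) O < (Num.min d e2)%:E)%E.
  have mO' : measurable O by exact: open_measurable.
  rewrite (measureDI (@lebesgue_measure R) mO' mN) [X in (_ + X)%E](_ : _ = 0%E) ?adde0//.
  apply/eqP; rewrite eq_le measure_ge0 andbT -N0 le_measure ?inE//.
  exact: measurableI.
have [t /andP[ta tb]| l Hl Hl2] :=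
  @chain_increment_bound F O c (e + e2) a b (addr_ge0 e0 (ltW e20)) ab oO.
  have [Nt|Nt] := pselect (N t); [by left; exact: NO|right].
  have tD : is_derive t 1 F (G t).
    apply: contrapT => nD; apply: Nt; apply: HN => /= H; apply: nD; apply: H.
    by rewrite in_itv/= (le_trans a0 ta) (le_trans tb bT).
  have /is_deriveP/(_ e2 e20)[r r0 Hr] := tD.
  exists r => // y /Hr H.
  have -> : F y - F t - c * (y - t) =
    (F y - F t - G t * (y - t)) + (G t - c) * (y - t) by ring.
  rewrite (le_trans (ler_normD _ _))// [leRHS]mulrDl addrC lerD//.
  by rewrite normrM ler_wpM2r// HG// ta.
have Sl : \sum_(p <- l) (p.2 - p.1) < Num.min d e2.
  rewrite -lte_fin (le_lt_trans (interval_chain_length oO Hl))//.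
  apply: le_lt_trans mO; apply: le_measure; rewrite ?inE; last exact: subIsetl.
    by apply: measurableI => //; exact: open_measurable.
  exact: open_measurable.
have SF : \sum_(p <- l) `|F p.2 - F p.1| < e2.
  rewrite (big_nth (0, 0)) big_mkord.
  apply: (Hd (size l) (fun i => (nth (0, 0) l i).1) (fun i => (nth (0, 0) l i).2)).
  - move=> i; have [? ? ? _] := interval_chain_nth Hl (ltn_ord i).
    by split; [lra|split => //; lra].
  - move=> i j ij; apply/seteqP; split => // y [/=].
    rewrite !in_itv/= => /andP[yi1 yi2] /andP[yj1 yj2].
    have [ij'|ji|/val_inj ijE] := ltngtP i j.
    + have := interval_chain_disj Hl ij' (ltn_ord j); lra.
    + have := interval_chain_disj Hl ji (ltn_ord i); lra.
    + by rewrite ijE eqxx in ij.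
  - by move: Sl; rewrite (big_nth (0, 0)) big_mkord lt_min => /andP[].
rewrite (le_trans Hl2)//.
have : \sum_(p <- l) `|F p.2 - F p.1 - c * (p.2 - p.1)| <=
    \sum_(p <- l) `|F p.2 - F p.1| + `|c| * \sum_(p <- l) (p.2 - p.1).
  rewrite mulr_sumr -big_split/= big_seq [leRHS]big_seq.
  apply: ler_sum => p pl.
  rewrite (le_trans (ler_normB _ _))// lerD// normrM ler_wpM2l// ger0_norm//.
  move: pl => /(nthP (0, 0))[i il <-]; rewrite subr_ge0.
  by have [] := interval_chain_nth Hl il.
have c0 := normr_ge0 c.
have : `|c| * \sum_(p <- l) (p.2 - p.1) <= `|c| * e2.
  by rewrite ler_wpM2l// ltW//; move: Sl; rewrite lt_min => /andP[].
have : e1 = e2 * (b - a) + e2 + `|c| * e2 by rewrite /e2 /k; field; exact: lt0r_neq0.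
lra.
Qed.

End NullDerivative.

Section LebesgueDefaultDisplay.
Context {R : realType}.

(** Lebesgue measure as a measure on R with its default display, on which the
    integrability condition in [L1_on] is stated. *)
Definition lebesgue_borel : set R -> \bar R := @lebesgue_measure R.

HB.instance Definition _ := isMeasure.Build default_measure_display R R
  lebesgue_borel (@measure0 _ _ _ (@lebesgue_measure R))
  (@measure_ge0 _ _ _ (@lebesgue_measure R))
  (@measure_semi_sigma_additive _ _ _ (@lebesgue_measure R)).

Lemma continuous_lebesgue_integrable (a b : R) (h : R -> R) (M : R) :
  {within `[a, b], continuous h} -> (forall x, x \in `[a, b] -> `|h x| <= M) ->
  (lebesgue_measure : set R -> \bar R).-integrable `[a, b] (EFin \o h).
Proof.
move=> ch hM; apply: (@measurable_bounded_integrable _ _ _ lebesgue_borel) => //.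
- rewrite /= /lebesgue_borel lebesgue_measure_itv/=.
  by case: ifPn => _; rewrite -?EFinB ltry.
- exact: subspace_continuous_measurable_fun.
- by exists M; split=> [|M' MM' x /hM xM]; [exact: num_real|rewrite /= (le_trans xM) ?ltW].
Qed.

End LebesgueDefaultDisplay.

(** * Integration of bounded functions and limits along ultrafilters *)

Lemma Rintegral_measure_eq {R : realType} d (T : measurableType d)
    (m1 m2 : {measure set T -> \bar R}) (f : T -> R) :
  m1 ≡μ m2 -> \int[m1]_z f z = \int[m2]_z f z.
Proof.
move=> m12; rewrite /Rintegral; congr fine.
by apply: eq_measure_integral => A mA _; exact: m12.
Qed.

Section BoundedIntegrals.
Context {R : realType} d (T : measurableType d) (P : probability T R).
Implicit Types f g : T -> R.

Lemma bounded_integrable f M : measurable_fun setT f ->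
  (forall x, `|f x| <= M) -> P.-integrable setT (EFin \o f).
Proof.
move=> mf fM; apply: measurable_bounded_integrable => //.
  by rewrite (le_lt_trans (probability_le1 P measurableT))// ltry.
by exists M; split=> [|M' MM' x _]; [rewrite num_real|rewrite /= (le_trans (fM x)) ?ltW].
Qed.

Lemma Rintegral_probability_cst c : \int[P]_x c = c.
Proof. by rewrite Rintegral_cst//= probability_setT mulr1. Qed.

Lemma le_norm_Rintegral_bound f M : P.-integrable setT (EFin \o f) ->
  (forall x, `|f x| <= M) -> `|\int[P]_x f x| <= M.
Proof.
move=> intf fM; rewrite (le_trans (le_normr_Rintegral measurableT intf))//.
rewrite -[leRHS]Rintegral_probability_cst; apply: le_Rintegral => //.
  exact: integrable_norm.
exact: finite_measure_integrable_cst.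
Qed.

Lemma Rintegral_sum p (f : 'I_p -> T -> R) :
  (forall i, P.-integrable setT (EFin \o f i)) ->
  P.-integrable setT (EFin \o (fun x => \sum_i f i x)) /\
  \int[P]_x (\sum_i f i x) = \sum_i \int[P]_x f i x.
Proof.
move=> fi.
have E : EFin \o (fun x => \sum_i f i x) = (fun x => \sum_i (f i x)%:E)%E.
  by apply/funext => x /=; rewrite sumEFin.
have iS : P.-integrable setT (EFin \o (fun x => \sum_i f i x)).
  by rewrite E; apply: integrable_sum => // i _; exact: fi.
split => //; apply: EFin_inj; rewrite /Rintegral -sumEFin fineK.
  under eq_integral do rewrite -sumEFin.
  rewrite integral_sum//; apply: eq_bigr => i _; rewrite fineK//.
  exact: integrable_fin_num (fi i).
exact: integrable_fin_num iS.
Qed.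

End BoundedIntegrals.

(** A set or its complement pulls back into the ultrafilter. *)
Lemma ultra_fmap I T (U : set_system I) (a : I -> T) :
  UltraFilter U -> UltraFilter (a @ U).
Proof.
move=> UU; split; first exact: fmap_proper_filter.
move=> G GF aG; apply/seteqP; split => // A GA.
have [//|UA] := in_ultra_setVsetC (a @^-1` A) UU.
by have /filter_ex[? []] : G (A `&` ~` A) by apply: filterI => //; exact: aG.
Qed.

Lemma cvg_norm_le {R : realType} I (F : set_system I) {FF : ProperFilter F}
    (a : I -> R) (l C : R) :
  (\forall k \near F, `|a k| <= C) -> a @ F --> l -> `|l| <= C.
Proof.
move=> aC al; suff : `[- C, C]%classic l by rewrite /= in_itv/= ler_norml.
apply: (closed_cvg _ _ _ _ al); first exact: itv_closed.
by apply: filterS aC => k; rewrite /= in_itv/= -ler_norml.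
Qed.

Section UltraLimits.
Context {R : realType} (U : set_system nat) {UU : UltraFilter U}.

Lemma ultra_bounded_cvg (a : nat -> R) M : (forall k, `|a k| <= M) ->
  cvg (a @ U).
Proof.
move=> aM; have := @segment_compact R (- M) M.
rewrite compact_ultra => /(_ (a @ U) (ultra_fmap a UU))[|l [_ al]].
  by apply: (@filterE _ U) => k /=; rewrite in_itv/= -ler_norml.
by apply/cvg_ex; exists l.
Qed.

End UltraLimits.

Section BoundedMeasurable.
Context {R : realType} d (T : measurableType d).

Definition bounded_measurable (h : T -> R) :=
  measurable_fun setT h /\ exists C : R, forall x, `|h x| <= C.

Lemma bounded_measurable_indic (A : set T) :
  measurable A -> bounded_measurable \1_A.
Proof.
move=> mA; split; first exact: measurable_indic.
by exists 1 => x; rewrite indicE ger0_norm//; case: (_ \in _).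
Qed.

Lemma bounded_measurableD h g : bounded_measurable h -> bounded_measurable g ->
  bounded_measurable (fun x => h x + g x).
Proof.
move=> [mh [C hC]] [mg [C' gC]]; split; first exact: measurable_funD.
by exists (C + C') => x; rewrite (le_trans (ler_normD _ _))// lerD.
Qed.

Lemma bounded_measurableZ c h :
  bounded_measurable h -> bounded_measurable (fun x => c * h x).
Proof.
move=> [mh [C hC]]; split; first exact: measurable_funM.
by exists (`|c| * C) => x; rewrite normrM ler_wpM2l.
Qed.

End BoundedMeasurable.

Section VanishOnIndicators.
Context {R : realType} d (T : measurableType d) (D : (T -> R) -> R) (K : R).
Hypothesis DD : forall h g, bounded_measurable h -> bounded_measurable g ->
  D (fun x => h x + g x) = D h + D g.
Hypothesis DZ : forall c h, bounded_measurable h ->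
  D (fun x => c * h x) = c * D h.
Hypothesis DK : forall h (C : R), bounded_measurable h ->
  (forall x, `|h x| <= C) -> `|D h| <= K * C.
Hypothesis D1 : forall A, measurable A -> D \1_A = 0.

(* For 0 <= t x <= m this is the integer part of t x, counted as the number of
   levels 1, 2, ..., m that t x reaches. *)
Let floor_fun (t : T -> R) (m : nat) (x : T) : R :=
  \sum_(j < m) \1_[set x | j.+1%:R <= t x] x.

Let measurable_level (t : T -> R) (c : R) : measurable_fun setT t ->
  measurable [set x | c <= t x].
Proof.
move=> mt; have := mt measurableT `[c, +oo[%classic (measurable_itv _).
rewrite setTI; congr measurable; apply/seteqP; split => x /=;
  by rewrite in_itv/= andbT.
Qed.

Let floor_fun_bm t m : measurable_fun setT t ->
  bounded_measurable (floor_fun t m) /\ D (floor_fun t m) = 0.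
Proof.
move=> mt; elim: m => [|m [IH1 IH2]].
  have -> : floor_fun t 0 = \1_set0.
    by apply/funext => x; rewrite /floor_fun big_ord0 indicE in_set0.
  by split; [exact: bounded_measurable_indic|exact: D1].
have mi : bounded_measurable (\1_[set x | m.+1%:R <= t x] : T -> R).
  by apply: bounded_measurable_indic; exact: measurable_level.
have -> : floor_fun t m.+1 = (fun x => floor_fun t m x + \1_[set x | m.+1%:R <= t x] x).
  by apply/funext => x; rewrite /floor_fun big_ord_recr.
split; first exact: bounded_measurableD.
by rewrite DD// IH2 D1 ?addr0//; exact: measurable_level.
Qed.

Let floor_fun_approx t m x : 0 <= t x <= m%:R -> `|t x - floor_fun t m x| <= 1.
Proof.
move=> /andP[t0 tm].
suff : if m%:R <= t x then floor_fun t m x = m%:R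
    else t x - 1 <= floor_fun t m x <= t x.
  by rewrite ler_norml; case: ifPn => [mt ->|_ /andP[? ?]]; apply/andP; split; lra.
elim: m {tm} => [|m].
  by rewrite /floor_fun big_ord0 t0.
rewrite /floor_fun !big_ord_recr/= -/(floor_fun t m x) indicE -natr1.
have [mt|tm] := leP (m%:R + 1) (t x).
  by rewrite mem_set//= ifT => [->//|]; lra.
rewrite memNset/= ?addr0; last by move=> /=; apply/negP; rewrite -ltNge.
by case: ifPn => [? ->|//]; lra.
Qed.

(** Linear combinations of indicators of level sets of h approximate h
    uniformly, and D is continuous for the supremum norm. *)
Lemma vanish_on_indicators h : bounded_measurable h -> D h = 0.
Proof.
move=> bh; have [mh [C hC]] := bh.
apply/eqP; rewrite -normr_le0; apply/ler_addgt0Pr => e e0; rewrite add0r.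
have K0 : 0 <= K by have := DK (bounded_measurable_indic measurableT) (C := 1);
  rewrite D1// normr0 mulr1; apply => x; rewrite indicE ger0_norm//; case: (_ \in _).
(* h + C is rescaled by m, so that rounding down to an integer is an error of
   at most 1/m on h. *)
pose m : nat := (Num.Def.trunc ((K + 1) / e)).+1.
have m0 : 0 < m%:R :> R by rewrite ltr0n.
have me : K / m%:R <= e.
  rewrite ler_pdivrMr// mulrC -ler_pdivrMr//.
  have : (K + 1) / e < m%:R by exact: truncnS_gt.
  move=> /ltW; apply: le_trans.
  by rewrite ler_wpM2r ?invr_ge0 ?(ltW e0)// lerDl.
pose t x := m%:R * (h x + C).
have mt : measurable_fun setT t by apply: measurable_funM => //; exact: measurable_funD.
pose n : nat := (Num.Def.trunc (2 * C * m%:R)).+1.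
have [bf Df] := floor_fun_bm n mt.
have bC : bounded_measurable (fun x => C * \1_[set: T] x).
  by apply: bounded_measurableZ; exact: bounded_measurable_indic.
pose g x := h x + (C * \1_[set: T] x + (- m%:R^-1) * floor_fun t n x).
have bg0 : bounded_measurable
    (fun x => C * \1_[set: T] x + (- m%:R^-1) * floor_fun t n x).
  by apply: bounded_measurableD => //; exact: bounded_measurableZ.
have -> : D h = D g.
  rewrite DD// DD//; last exact: bounded_measurableZ.
  by rewrite DZ ?D1 ?DZ ?Df ?mulr0 ?addr0//; exact: bounded_measurable_indic.
apply: le_trans me; apply: DK; first exact: bounded_measurableD.
move=> x; rewrite /g indicT mulr1.
have -> : h x + (C + - m%:R^-1 * floor_fun t n x) = m%:R^-1 * (t x - floor_fun t n x).
  by rewrite /t; field; exact: lt0r_neq0.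
have mi0 : 0 <= (m%:R^-1 : R) by rewrite invr_ge0.
rewrite normrM (ger0_norm mi0) -[leRHS]mulr1 ler_wpM2l//.
have := hC x; rewrite ler_norml => /andP[h1 h2].
apply: floor_fun_approx; rewrite /t; apply/andP; split.
  by rewrite mulr_ge0 ?(ltW m0)//; lra.
apply: le_trans (ltW (truncnS_gt _)).
by rewrite mulrC ler_wpM2r ?(ltW m0)//; lra.
Qed.

End VanishOnIndicators.

(** * Setwise limits of barycentres *)

(** Probabilities P k with the same image mu under p carry signed measures
    A |-> integral of q over p^-1 A against P k, all of them dominated by M mu.
    Along an ultrafilter they converge on every measurable set, the limit is
    dominated by M mu as well, and its density b is the limit barycentre of q
    over the fibres of p. *)
Section Barycenter.
Context {R : realType} d (T : measurableType d) (mu : probability T R).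
Context d' (S : measurableType d') (P : nat -> probability S R).
Context (p : S -> T) (mp : measurable_fun setT p).
Hypothesis PE : forall k A, measurable A -> P k (p @^-1` A) = mu A.
Context (q : S -> R) (mq : measurable_fun setT q) (M : R).
Hypothesis qM : forall z, `|q z| <= M.
Context (U : set_system nat) {UU : UltraFilter U}.


Let J h k := \int[P k]_z (h (p z) * q z).

Let intJ h k : bounded_measurable h ->
  (P k).-integrable setT (EFin \o (fun z => h (p z) * q z)).
Proof.
move=> [mh [C hC]]; apply: (@bounded_integrable _ _ _ _ _ (C * M)).
  by apply: measurable_funM => //; exact: measurableT_comp.
by move=> z; rewrite normrM ler_pM.
Qed.

Let JD h g k : bounded_measurable h -> bounded_measurable g ->
  J (fun x => h x + g x) k = J h k + J g k.
Proof.
move=> bh bg; rewrite /J -RintegralD//; [|exact: intJ|exact: intJ].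
by apply: eq_Rintegral => z _; rewrite mulrDl.
Qed.

Let JZ c h k : bounded_measurable h -> J (fun x => c * h x) k = c * J h k.
Proof.
move=> bh; rewrite /J -RintegralZl//; last exact: intJ.
by apply: eq_Rintegral => z _; rewrite mulrA.
Qed.

Let J_le h k (C : R) : bounded_measurable h -> (forall x, `|h x| <= C) ->
  `|J h k| <= M * C.
Proof.
move=> bh hC; apply: le_norm_Rintegral_bound; first exact: intJ.
by move=> z; rewrite normrM mulrC ler_pM.
Qed.

Let J_indic A k : measurable A -> `|J \1_A k| <= M * fine (mu A).
Proof.
move=> mA; have iJ := intJ k (bounded_measurable_indic mA).
rewrite (le_trans (le_normr_Rintegral measurableT iJ))//.
have -> : fine (mu A) = \int[P k]_z \1_A (p z).
  have -> : (fun z => \1_A (p z)) = \1_(p @^-1` A) :> (S -> R).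
    by apply/funext => z; rewrite !indicE.
  rewrite /Rintegral integral_indic// ?setIT/= ?PE//.
  by rewrite -[X in measurable X]setTI; exact: mp.
have iA : (P k).-integrable setT (EFin \o (fun z => \1_A (p z) : R)).
  have [mi [C iC]] : bounded_measurable (\1_A : T -> R).
    exact: bounded_measurable_indic.
  apply: (@bounded_integrable _ _ _ _ _ C) => [|z]; last exact: iC.
  exact: measurableT_comp.
rewrite -RintegralZl//; apply: le_Rintegral => //.
- exact/integrable_norm/intJ/bounded_measurable_indic.
- exact: (integrableZl measurableT M iA).
- move=> z _; rewrite normrM mulrC (ger0_norm (_ : 0 <= \1_A (p z))) ?ler_wpM2r//.
Qed.

Let L h : R := lim (J h @ U).

Let J_cvg h : bounded_measurable h -> J h @ U --> L h.
Proof.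
move=> bh; have [_ [C hC]] := bh.
by apply: (ultra_bounded_cvg (M := M * C)) => k; exact: J_le.
Qed.

Let LD h g : bounded_measurable h -> bounded_measurable g ->
  L (fun x => h x + g x) = L h + L g.
Proof.
move=> bh bg; apply: cvg_lim => //.
rewrite (_ : J _ = J h \+ J g); last by apply/funext => k; exact: JD.
by apply: cvgD; exact: J_cvg.
Qed.

Let LZ c h : bounded_measurable h -> L (fun x => c * h x) = c * L h.
Proof.
move=> bh; apply: cvg_lim => //.
rewrite (_ : J _ = (fun k => c * J h k)); last by apply/funext => k; exact: JZ.
by apply: cvgMr; exact: J_cvg.
Qed.

Let L_le h (C : R) : bounded_measurable h -> (forall x, `|h x| <= C) ->
  `|L h| <= M * C.
Proof.
move=> bh hC; apply: (cvg_norm_le _ (J_cvg bh)).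
by apply: filterE => k; exact: J_le.
Qed.

Let L_indic A : measurable A -> `|L \1_A| <= M * fine (mu A).
Proof.
move=> mA; apply: (cvg_norm_le _ (J_cvg (bounded_measurable_indic mA))).
by apply: filterE => k; exact: J_indic.
Qed.

(** Additivity survives the limit along U; countable additivity comes from the
    domination by M mu. *)
Definition limit_charge (A : set T) : \bar R := (L \1_A)%:E.

Let limit_charge0 : limit_charge set0 = 0%E.
Proof.
by have := L_indic measurable0; rewrite measure0 mulr0 normr_le0 /limit_charge => /eqP ->.
Qed.

Let limit_charge_fin A : measurable A -> limit_charge A \is a fin_num.
Proof. by []. Qed.

Let limit_charge_add2 : additive2 limit_charge.
Proof.
move=> A B mA mB AB; rewrite /limit_charge -EFinD -LD; [|exact: bounded_measurable_indic..].
congr (L _)%:E; apply/funext => x; rewrite !indicE.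
have [xA|xA] := pselect (A x).
  rewrite mem_set; last by left.
  rewrite mem_set// memNset ?addr0// => xB.
  by have : (A `&` B) x by []; rewrite AB.
rewrite (memNset xA) add0r; have [xB|xB] := pselect (B x).
  by rewrite !mem_set//; right.
by rewrite !memNset// => -[].
Qed.

Let limit_charge_sigma : semi_sigma_additive limit_charge.
Proof.
move=> F mF tF mUF.
have bU n : (\sum_(0 <= i < n) limit_charge (F i) =
    limit_charge (\big[setU/set0]_(i < n) F i))%E.
  rewrite big_mkord; apply/esym.
  have /(additive2P limit_charge0) := limit_charge_add2; apply => //.
  exact: bigsetU_measurable.
under eq_fun do rewrite bU.
have mC n : measurable (\bigcup_n F n `\` \big[setU/set0]_(i < n) F i).
  by apply: measurableD => //; exact: bigsetU_measurable.
have sub n : \big[setU/set0]_(i < n) F i `<=` \bigcup_n F n.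
  by rewrite -bigcup_mkord; apply: bigcup_sub => i _; exact: bigcup_sup.
have bD n : L \1_(\bigcup_n F n) = L \1_(\big[setU/set0]_(i < n) F i) +
    L \1_(\bigcup_n F n `\` \big[setU/set0]_(i < n) F i).
  have := @limit_charge_add2 (\big[setU/set0]_(i < n) F i)
    (\bigcup_n F n `\` \big[setU/set0]_(i < n) F i).
  rewrite setDUK// setDIK /limit_charge -EFinD => H; apply: EFin_inj; apply: H => //.
  exact: bigsetU_measurable.
apply/fine_cvgP; split; first exact: nearW.
apply/cvgrPdist_le => e e0.
(* The tails decrease to the empty set, so their mu-measure tends to 0, and the
   charge of a tail is at most M times its mu-measure. *)
have cap0 : \bigcap_n (\bigcup_n F n `\` \big[setU/set0]_(i < n) F i) = set0.
  apply/seteqP; split => // x H; have [[i _ Fi] _] := H 0%N I.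
  have [_] := H i.+1 I; apply; rewrite big_ord_recr/=; by right.
have mcvg : mu (\bigcup_n F n `\` \big[setU/set0]_(i < n) F i) @[n --> \oo] --> 0%E.
  have := @nonincreasing_cvg_mu _ _ _ mu
    (fun n => \bigcup_n F n `\` \big[setU/set0]_(i < n) F i).
  rewrite cap0 measure0; apply => //.
  - by rewrite (le_lt_trans (probability_le1 mu _))// ltry.
  - move=> m n mn; apply/subsetPset => x [xU nx]; split => // xm; apply: nx.
    move: xm; rewrite -!bigcup_mkord => -[i im Fi].
    by exists i => //=; exact: leq_trans mn.
move: mcvg => /fine_cvg/cvgrPdist_le/(_ (e / (M + 1))).
have M0 : 0 <= M by apply: le_trans (qM point).
rewrite divr_gt0//; last lra; move=> /(_ isT); apply: filterS => n /=.
rewrite sub0r normrN ger0_norm ?fine_ge0// => H.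
rewrite (bD n) addrAC subrr add0r (le_trans (L_indic (mC n)))//.
rewrite (@le_trans _ _ (M * (e / (M + 1))))// ?ler_wpM2l//.
by rewrite mulrCA ger_pMr// ler_pdivrMr; lra.
Qed.

HB.instance Definition _ := isCharge.Build _ _ _ limit_charge
  limit_charge0 limit_charge_fin limit_charge_sigma.

Lemma setwise_barycenter : exists b : T -> R,
  [/\ measurable_fun setT b, mu.-integrable setT (EFin \o b) &
   forall (h : T -> R) (C : R), measurable_fun setT h -> (forall x, `|h x| <= C) ->
    (fun k => \int[P k]_z (h (p z) * q z)) @ U --> \int[mu]_x (h x * b x)].
Proof.
have M0 : 0 <= M by apply: le_trans (qM point).
have bmu : limit_charge `<< mu.
  apply/null_content_dominatesP => A mA muA0.
  by have := L_indic mA; rewrite muA0 mulr0 normr_le0 /limit_charge => /eqP ->.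
pose f := Radon_Nikodym limit_charge mu.
have fi : mu.-integrable setT f by exact: Radon_Nikodym_integrable.
have ffin x : f x \is a fin_num by exact: Radon_Nikodym_fin_num.
pose b x := fine (f x).
have bf : EFin \o b = f by apply/funext => x /=; rewrite fineK.
have bi : mu.-integrable setT (EFin \o b) by rewrite bf.
have mb : measurable_fun setT b by apply/measurable_EFinP; exact: measurable_int bi.
have ihb h : bounded_measurable h -> mu.-integrable setT (EFin \o (fun x => h x * b x)).
  move=> [mh [C hC]]; apply: (integrableMr measurableT mh _ bi).
  by exists C; split=> [|C' CC' x _]; rewrite ?num_real//= (le_trans (hC x)) ?ltW.
exists b; split => // h C mh hC.
have bh : bounded_measurable h by split => //; exists C.
rewrite (_ : \int[mu]_x (h x * b x) = L h); first exact: J_cvg.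
(* The limit functional and integration against b agree on indicators by the
   definition of the density. *)
pose D h := L h - \int[mu]_x (h x * b x).
apply/esym/subr0_eq; rewrite -/(D h).
apply: (@vanish_on_indicators _ _ _ D (M + \int[mu]_x `|b x|)) => //.
- move=> h1 h2 b1 b2; rewrite /D (LD b1 b2).
  under eq_Rintegral do rewrite mulrDl.
  by rewrite RintegralD//; [ring|exact: ihb..].
- move=> c h1 b1; rewrite /D (LZ _ b1) mulrBr; congr (_ - _).
  under eq_Rintegral do rewrite -mulrA.
  by rewrite RintegralZl//; exact: ihb.
- move=> h1 C1 b1 hC1; rewrite /D mulrDl.
  rewrite (le_trans (ler_normB _ _))// lerD//; first exact: L_le.
  rewrite (le_trans (le_normr_Rintegral measurableT (ihb _ b1)))//.
  rewrite -RintegralZr//; last exact: integrable_norm.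
  apply: le_Rintegral => //; first exact/integrable_norm/ihb.
    by apply: (integrableZr measurableT C1 (integrable_norm bi)).
  by move=> x _; rewrite normrM mulrC ler_wpM2l.
- move=> A mA; apply/eqP; rewrite subr_eq0; apply/eqP.
  apply: EFin_inj; rewrite -[LHS]/(limit_charge A).
  rewrite (Radon_Nikodym_integral bmu mA) -/f -bf.
  rewrite integral_mkcond /Rintegral fineK.
    apply: eq_integral => x _; rewrite patchE /= indicE.
    by case: ifPn; rewrite ?mul1r ?mul0r.
  exact/integrable_fin_num/ihb/bounded_measurable_indic.
Qed.

End Barycenter.

(** * Images of measures and Borel measurability *)

Section Transfer.
Context {R : realType} d1 d2 (S : measurableType d1) (T : measurableType d2).
Context (phi : S -> T) (mphi : measurable_fun setT phi).
Context (P : probability S R) (Q : probability T R).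
Hypothesis QE : forall A, measurable A -> Q A = P (phi @^-1` A).

Let eqm A : measurable A -> A `<=` [set: T] ->
  Q A = pushforward P (mfun_Sub (mem_set mphi)) A.
Proof. by move=> mA _; rewrite QE. Qed.

Lemma ge0_integral_image (f : T -> \bar R) : measurable_fun setT f ->
  (forall y, 0 <= f y)%E ->
  (\int[Q]_y f y = \int[P]_x f (phi x))%E.
Proof.
move=> mf f0.
rewrite (eq_measure_integral _ eqm) ge0_integral_pushforward//.
Qed.

Lemma integrable_image (f : T -> R) : measurable_fun setT f ->
  P.-integrable setT (EFin \o (f \o phi)) -> Q.-integrable setT (EFin \o f).
Proof.
move=> mf fi; apply/integrableP; split; first exact/measurable_EFinP.
rewrite ge0_integral_image//; last first.
  exact/measurableT_comp/measurable_EFinP.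
by case/integrableP : fi.
Qed.

Lemma Rintegral_image (f : T -> R) : measurable_fun setT f ->
  P.-integrable setT (EFin \o (f \o phi)) ->
  \int[Q]_y f y = \int[P]_x f (phi x).
Proof.
move=> mf fi; rewrite /Rintegral (eq_measure_integral _ eqm).
by rewrite integral_pushforward//; exact/measurable_EFinP.
Qed.

End Transfer.

Section BorelReal.
Context {R : realType}.

Lemma continuous_measurable_real (T : ptopologicalType) (f : T -> R) :
  continuous f -> measurable_fun [set: borel T] (f : borel T -> R).
Proof.
move=> /continuousP cf; apply: (measurability _ (RGenOpens.measurableE R)).
move=> _ [_ [a [b ->] <-]]; rewrite setTI; apply: sub_sigma_algebra.
exact/cf/interval_open.
Qed.

Lemma open_borel_measurable (T : ptopologicalType) (A : set T) :
  open A -> measurable (A : set (borel T)).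
Proof. exact: sub_sigma_algebra. Qed.

Lemma continuous_bounded_integrable (T : ptopologicalType) (P : 'P[R] T)
    (f : T -> R) (M : R) :
  continuous f -> (forall x, `|f x| <= M) -> P.-integrable setT (EFin \o f).
Proof.
move=> cf fM; apply: (@bounded_integrable _ _ _ P f M) => //.
exact: continuous_measurable_real.
Qed.

(** The sigma-algebra on the product is generated by its open sets, not by
    rectangles. Both agree because every open set is a countable union of boxes
    with rational centres and radii 1/(k+1). *)
Lemma measurable_fun_prod_rV n d (T : measurableType d)
    (f g : T -> 'rV[R]_n) :
  (forall i, measurable_fun setT (fun x => f x ord0 i)) ->
  (forall i, measurable_fun setT (fun x => g x ord0 i)) ->
  measurable_fun setT ((fun x => (f x, g x)) : T -> borel ('rV[R]_n * 'rV[R]_n)%type).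
Proof.
move=> mf mg; apply: (measurability (@open ('rV[R]_n * 'rV[R]_n)%type :
  set (set (borel ('rV[R]_n * 'rV[R]_n)%type)))) => //.
move=> _ [W oW <-]; rewrite setTI.
pose box (k : ('rV[rat]_n * 'rV[rat]_n) * nat) : set ('rV[R]_n * 'rV[R]_n) :=
  [set z : 'rV[R]_n * 'rV[R]_n | forall i, `|z.1 ord0 i - ratr (k.1.1 ord0 i)| < k.2.+1%:R^-1 /\
                     `|z.2 ord0 i - ratr (k.1.2 ord0 i)| < k.2.+1%:R^-1].
have -> : W = \bigcup_(k in [set k | box k `<=` W]) box k.
  apply/seteqP; split => [z Wz|z [k /= kW]]; last exact: kW.
  have /nbhs_ballP[e /= e0 eW] : nbhs z W by exact: open_nbhs_nbhs.
  pose k : nat := Num.Def.trunc (2 / e).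
  have k0 : 0 < (k.+1%:R^-1 : R) by rewrite invr_gt0.
  have ke : k.+1%:R^-1 < e / 2.
    have : 2 / e < k.+1%:R by exact: truncnS_gt.
    rewrite -(invf_div e) => H; rewrite -[ltRHS]invrK.
    by rewrite ltf_pV2// posrE ?invr_gt0 ?divr_gt0.
  have rat_near (x : R) : exists q : rat, `|x - ratr q| < k.+1%:R^-1.
    have xk : x - k.+1%:R^-1 < x + k.+1%:R^-1 by rewrite ltrD2l gtrN.
    have [q] := rat_in_itvoo xk; rewrite in_itv/= => /andP[q1 q2]; exists q.
    by rewrite ltr_distlC q1.
  pose q (x : 'rV[R]_n) : 'rV[rat]_n := \row_i sval (cid (rat_near (x ord0 i))).
  have qE (x : 'rV[R]_n) i : `|x ord0 i - ratr (q x ord0 i)| < k.+1%:R^-1.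
    by rewrite mxE; case: cid.
  exists (q z.1, q z.2, k); last by move=> i; split; exact: qE.
  move=> w /= wk; apply: eW.
  have lt_e (r x y p : R) : r < e / 2 -> `|x - p| < r -> `|y - p| < r ->
      ball x e y.
    rewrite -ball_normE /= !ltr_norml => re /andP[? ?] /andP[? ?].
    by apply/andP; split; lra.
  split; split=> // i j; rewrite ord1; have [wk1 wk2] := wk j.
    exact: lt_e ke (qE _ _) wk1.
  exact: lt_e ke (qE _ _) wk2.
rewrite preimage_bigcup bigcup_mkcond.
apply: countable_bigcupT_measurable => // k; case: ifPn => // _.
have -> : (fun x => (f x, g x)) @^-1` box k = \bigcap_(i in [set: 'I_n])
    ((fun x => f x ord0 i) @^-1` (ball (ratr (k.1.1 ord0 i) : R) k.2.+1%:R^-1) `&`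
     (fun x => g x ord0 i) @^-1` (ball (ratr (k.1.2 ord0 i) : R) k.2.+1%:R^-1)).
  apply/seteqP; split => [x H i _|x H i].
    by have [H1 H2] := H i; split; rewrite -ball_normE/= distrC.
  by have := H i I; rewrite -ball_normE/= => -[H1 H2]; split; rewrite distrC.
apply: fin_bigcap_measurable => // i _; apply: measurableI.
  by rewrite -[X in measurable X]setTI; apply: mf => //; exact: measurable_ball.
by rewrite -[X in measurable X]setTI; apply: mg => //; exact: measurable_ball.
Qed.

End BorelReal.

(** * Uniform continuity, Euclidean and control distances *)

Section UniformContinuity.
Context {R : realType}.

(** Heine's theorem, with only one of the two points in the compact set. *)
Lemma compact_unif_cont (T : pseudoMetricType R) (f : T -> R) (S : set T) e :
  continuous f -> compact S -> 0 < e ->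
  exists2 r, 0 < r & forall x y, S x -> ball x r y -> `|f x - f y| < e.
Proof.
move=> cf /compact_near_coveringP cS e0.
have e20 : 0 < e / 2 by rewrite divr_gt0.
have near0 : \forall r \near 0^'+,
    S `<=` (fun x => forall y, ball x r y -> `|f x - f y| < e).
  apply: cS.
  move=> x Sx.
  have /cvgrPdist_lt/(_ _ e20)/nbhs_ballP[r /= r0 Hr] := cf x.
  have r20 : 0 < r / 2 by rewrite divr_gt0.
  near=> x' d => y xy.
  have h1 : ball x (r / 2) x' by near: x'; exact: nbhsx_ballx.
  have h2 : d <= r / 2 by near: d; exact: nbhs_right_le.
  have h3 : ball x r y.
    by rewrite (splitr r); apply: ball_triangle h1 (le_ball h2 xy).
  have h4 : ball x r x' by apply: le_ball h1; lra.
  have := Hr _ h3; have := Hr _ h4; rewrite /= !ltr_norml.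
  by move=> /andP[? ?] /andP[? ?]; apply/andP; split; lra.
near (0 : R)^'+ => r.
exists r; first by near: r; exact: nbhs_right_gt.
have H : S `<=` (fun x => forall y, ball x r y -> `|f x - f y| < e) by near: r.
by move=> x y Sx; exact: H.
Unshelve. all: by end_near. Qed.

(** At distances below the radius r of uniform continuity the error is at most
    e; beyond r the bound 2 M <= (2 M / r) D is enough. Two points outside the
    support need no comparison, so the modulus holds on the whole space. *)
Lemma unif_modulus (T : pseudoMetricType R) (f : T -> R) (S : set T) (M : R)
    (D : T -> T -> R) e :
  continuous f -> compact S -> (forall x, ~ S x -> f x = 0) ->
  (forall x, `|f x| <= M) -> (forall x y, 0 <= D x y) ->
  (forall x y r, D x y < r -> ball x r y) -> 0 < e ->
  exists2 c, 0 <= c & forall x y, `|f x - f y| <= e + c * D x y.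
Proof.
move=> cf cS fS fM D0 Dball e0.
have [r r0 Hr] := compact_unif_cont cf cS e0.
exists (2 * `|M| / r) => [|x y]; first by rewrite divr_ge0// ?mulr_ge0// ltW.
have M0 : 0 <= M by apply: le_trans (fM x).
rewrite (ger0_norm M0).
have c0 : 0 <= 2 * M / r by rewrite divr_ge0 ?mulr_ge0// ltW.
have cD : 0 <= 2 * M / r * D x y by rewrite mulr_ge0.
have [Dr|rD] := ltP (D x y) r.
  have xy := Dball _ _ _ Dr.
  have [Sx|/fS fx] := pselect (S x).
    by rewrite (le_trans (ltW (Hr _ _ Sx xy)))// lerDl.
  have [Sy|/fS fy] := pselect (S y).
    by rewrite distrC (le_trans (ltW (Hr _ _ Sy (ball_sym xy))))// lerDl.
  by rewrite fx fy subrr normr0 addr_ge0// ltW.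
apply: (@le_trans _ _ (2 * M)).
  rewrite (le_trans (ler_normB _ _))// (mulrDl 1 1) mul1r.
  by rewrite lerD.
rewrite -[leLHS]add0r lerD ?(ltW e0)//.
have -> : 2 * M / r * D x y = 2 * M * (D x y / r) by rewrite mulrAC mulrA.
rewrite -[leLHS]mulr1 ler_wpM2l ?mulr_ge0//.
by rewrite ler_pdivlMr// mul1r.
Qed.

End UniformContinuity.

Section Geometry.
Context {R : realType}.

Lemma continuous_sum_ord (T : topologicalType) n (F : 'I_n -> T -> R) :
  (forall i, continuous (F i)) -> continuous (fun x => \sum_i F i x).
Proof. by move=> cF; apply: continuous_big => //; exact: add_continuous. Qed.

Lemma continuous_dotp (T : topologicalType) n (f g : T -> 'rV[R]_n) :
  continuous f -> continuous g -> continuous (fun x => dotp (f x) (g x)).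
Proof.
move=> cf cg; apply: continuous_sum_ord => i x; apply: cvgM.
  by apply: (@continuous_comp _ _ _ f (fun v : 'rV[R]_n => v ord0 i));
    [exact: cf|exact: coord_continuous].
by apply: (@continuous_comp _ _ _ g (fun v : 'rV[R]_n => v ord0 i));
  [exact: cg|exact: coord_continuous].
Qed.

Lemma continuous_eucl_dist (T : topologicalType) n (f g : T -> 'rV[R]_n) :
  continuous f -> continuous g -> continuous (fun x => eucl_dist (f x) (g x)).
Proof.
move=> cf cg x.
apply: (@continuous_comp _ _ _ (fun x => dotp (f x - g x) (f x - g x)) Num.sqrt).
  by apply: continuous_dotp => y; apply: cvgB; [exact: cf|exact: cg|exact: cf|exact: cg].
exact: sqrt_continuous.
Qed.

Lemma eucl_dist_ge0 n (x y : 'rV[R]_n) : 0 <= eucl_dist x y.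
Proof. exact: sqrtr_ge0. Qed.

Context {Y : metricType R} {U : set Y} {u0 : U}.
Local Notation C := (ctrl u0).

Lemma ctrl_dist_ge0 (u w : C) : 0 <= ctrl_dist u w.
Proof. exact: mdist_ge0. Qed.

Lemma ball_ctrlE (u w : C) e : ball u e w <-> ctrl_dist u w < e.
Proof.
suff -> : ball u e w = ball (ctrl_val u) e (ctrl_val w) by rewrite ballEmdist.
by [].
Qed.

Lemma continuous_ctrl_dist (T : topologicalType) (f g : T -> C) :
  continuous f -> continuous g -> continuous (fun x => ctrl_dist (f x) (g x)).
Proof.
move=> cf cg x; apply/cvgrPdist_lt => e e0.
have e20 : 0 < e / 2 by rewrite divr_gt0.
have Hf : \forall t \near x, ball (f x) (e / 2) (f t).
  by apply: cf; exact: nbhsx_ballx.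
have Hg : \forall t \near x, ball (g x) (e / 2) (g t).
  by apply: cg; exact: nbhsx_ballx.
near=> t.
have /ball_ctrlE h1 : ball (f x) (e / 2) (f t) by near: t.
have /ball_ctrlE h2 : ball (g x) (e / 2) (g t) by near: t.
move: h1 h2; rewrite /ctrl_dist.
move: (ctrl_val (f x)) (ctrl_val (g x)) (ctrl_val (f t)) (ctrl_val (g t)).
move=> a b a' b' h1 h2.
have := metric_triangle a a' b; have := metric_triangle a' b' b.
have := metric_triangle a' a b'; have := metric_triangle a b b'.
rewrite (metric_sym a' a) (metric_sym b' b) ltr_norml => *.
by apply/andP; split; lra.
Unshelve. all: by end_near. Qed.

(** The topology of the control space is induced by the inclusion into Y, so an
    ultrafilter converges as soon as its image does. *)
Lemma compact_ctrl : compact U -> compact [set: C].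
Proof.
rewrite !compact_ultra => cK F UF _.
have [|y [Ky Fy]] := cK ((@ctrl_val R Y U u0) @ F) (ultra_fmap _ UF).
  by apply: (@filterE _ F) => u /=; exact: set_valP.
pose u : C := exist _ y (mem_set Ky).
exists u; split => //= A /nbhs_ballP[e /= e0 eA].
have : F ((@ctrl_val R Y U u0) @^-1` ball y e) by apply: Fy; exact: nbhsx_ballx.
by apply: filterS => w yw; apply: eA.
Qed.

End Geometry.

(** * Couplings and test functions *)

Section CouplingTests.
Context {R : realType}.

(** The easy half of Kantorovich duality, with an additive error e so that it
    applies to functions that are only uniformly continuous. *)
Lemma coupling_test (Z : ptopologicalType) (nu1 nu2 : 'P[R] Z)
    (tau : 'P[R] (Z * Z)) (psi : Z -> R) (c : Z * Z -> R) (M e : R) :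
  couplings nu1 nu2 tau -> continuous psi -> (forall z, `|psi z| <= M) ->
  tau.-integrable setT (EFin \o c) ->
  (forall z, `|psi z.1 - psi z.2| <= e + c z) ->
  `|\int[nu1]_z psi z - \int[nu2]_z psi z| <= e + \int[tau]_z c z.
Proof.
move=> [t1 t2] cpsi psiM ic le_c.
have mpsi := continuous_measurable_real cpsi.
have m1 := continuous_measurable_borel (@fst_cont Z Z).
have m2 := continuous_measurable_borel (@snd_cont Z Z).
have i1 : tau.-integrable setT (EFin \o (psi \o fst)).
  apply: (@bounded_integrable _ _ _ _ _ M) => [|z]; last exact: psiM.
  exact: measurableT_comp mpsi m1.
have i2 : tau.-integrable setT (EFin \o (psi \o snd)).
  apply: (@bounded_integrable _ _ _ _ _ M) => [|z]; last exact: psiM.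
  exact: measurableT_comp mpsi m2.
rewrite (Rintegral_image m1 (P := tau) _ mpsi i1); last by move=> A mA; rewrite -t1.
rewrite (Rintegral_image m2 (P := tau) _ mpsi i2); last by move=> A mA; rewrite -t2.
rewrite -RintegralB//.
have i12 : tau.-integrable setT (EFin \o (fun z => psi z.1 - psi z.2)).
  have := integrableB measurableT i1 i2; congr (_.-integrable _ _).
rewrite (le_trans (le_normr_Rintegral measurableT i12))//.
have ie : tau.-integrable setT (EFin \o (cst e : borel (Z * Z)%type -> R)).
  exact: finite_measure_integrable_cst.
rewrite -[e in leRHS](Rintegral_probability_cst tau) -RintegralD//.
apply: le_Rintegral => //; first exact: integrable_norm.
exact: (integrableD measurableT ie ic).
Qed.

Lemma transport_cost_integrable (S T : ptopologicalType) (d : S -> T -> R)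
    (tau : 'P[R] (S * T)) (r : R) :
  continuous (fun z : S * T => d z.1 z.2) -> (forall x y, 0 <= d x y) ->
  (transport_cost d tau <= r%:E)%E ->
  tau.-integrable setT (EFin \o (fun z => d z.1 z.2)) /\
  \int[tau]_z d z.1 z.2 <= r.
Proof.
move=> cd d0 dr.
have it : tau.-integrable setT (EFin \o (fun z => d z.1 z.2)).
  apply/integrableP; split.
    by apply/measurable_EFinP; exact: (continuous_measurable_real cd).
  under eq_integral do rewrite /= ger0_norm//.
  by rewrite (le_lt_trans dr)// ltry.
split => //; rewrite -lee_fin; apply: le_trans dr.
by rewrite /Rintegral fineK//; exact: integrable_fin_num.
Qed.

Lemma wasserstein_measure_eq (T : ptopologicalType) (d : T -> T -> R)
    (mu1 mu2 nu1 nu2 : 'P[R] T) :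
  mu1 ≡μ nu1 -> mu2 ≡μ nu2 -> wasserstein d mu1 mu2 = wasserstein d nu1 nu2.
Proof.
move=> e1 e2; rewrite /wasserstein; congr ereal_inf; congr (_ @` _).
apply/seteqP; split => tau [t1 t2]; split => A mA;
  by rewrite ?(t1 _ mA) ?(t2 _ mA) ?(e1 _ mA) ?(e2 _ mA).
Qed.

Lemma W1_test n (mu nu : 'P[R] 'rV[R]_n) (phi : 'rV[R]_n -> R) (M e c r : R) :
  continuous phi -> (forall x, `|phi x| <= M) -> 0 <= c ->
  (forall x y, `|phi x - phi y| <= e + c * eucl_dist x y) ->
  (W1 mu nu < r%:E)%E ->
  `|\int[mu]_x phi x - \int[nu]_x phi x| <= e + c * r.
Proof.
move=> cphi phiM c0 phic /ereal_inf_lt[_ [tau ctau <-] /ltW].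
case/transport_cost_integrable => [||id dr].
- by apply: continuous_eucl_dist; [exact: fst_cont|exact: snd_cont].
- exact: eucl_dist_ge0.
have := @coupling_test _ mu nu tau phi (fun z => c * eucl_dist z.1 z.2) M e.
move=> /(_ ctau cphi phiM); rewrite RintegralZl// => H.
apply: (le_trans (H _ _)); last by rewrite lerD2l ler_wpM2l.
  exact: (integrableZl measurableT c id).
by move=> z; exact: phic.
Qed.

(** Both costs are controlled by the same plan: its X-marginal is optimal, so
    that the integral of dX is the Wasserstein distance of the marginals. *)
Lemma wasserstein_pseudo_test (X Z : ptopologicalType) (dX : X -> X -> R)
    (dZ : Z -> Z -> R) (nu1 nu2 : 'P[R] (X * Z)) (psi : X * Z -> R)
    (M e c r1 r2 : R) :
  continuous (fun z : X * X => dX z.1 z.2) -> (forall x y, 0 <= dX x y) ->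
  continuous (fun z : Z * Z => dZ z.1 z.2) -> (forall x y, 0 <= dZ x y) ->
  continuous psi -> (forall z, `|psi z| <= M) -> 0 <= c ->
  (forall x u y w, `|psi (x, u) - psi (y, w)| <= e + c * (dX x y + dZ u w)) ->
  (wasserstein dX (marginal1 nu1) (marginal1 nu2) <= r1%:E)%E ->
  (wasserstein_pseudo dX dZ nu1 nu2 < r2%:E)%E ->
  `|\int[nu1]_z psi z - \int[nu2]_z psi z| <= e + c * (r1 + r2).
Proof.
move=> cdX dX0 cdZ dZ0 cpsi psiM c0 psic W1r.
move=> /ereal_inf_lt[_ [tau [ctau [copt opt]] <-] /ltW].
case/transport_cost_integrable => [||id dr].
- move=> z; apply: (@cvg_comp _ _ _ (fun z : (X * Z) * (X * Z) => (z.1.2, z.2.2))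
    (fun z : Z * Z => dZ z.1 z.2)); last exact: (cdZ (z.1.2, z.2.2)).
  by apply: cvg_pair;
    [apply: (@cvg_comp _ _ _ fst snd); [exact: cvg_fst|exact: cvg_snd]
    |apply: (@cvg_comp _ _ _ snd snd); [exact: cvg_snd|exact: cvg_snd]].
- by move=> x y; exact: dZ0.
move: W1r; rewrite -opt.
case/(transport_cost_integrable cdX dX0) => ix xr.
have m13 := continuous_measurable_borel (@proj13_cont X Z).
have md := continuous_measurable_real cdX.
have ix' : tau.-integrable setT (EFin \o (fun z => dX z.1.1 z.2.1)).
  apply/integrableP; split; first by apply/measurable_EFinP; exact: measurableT_comp md m13.
  case/integrableP : ix => _.
  rewrite (ge0_integral_image m13 (P := tau))//.
  exact/measurableT_comp/measurable_EFinP.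
have xr' : \int[tau]_z dX z.1.1 z.2.1 <= r1.
  by move: xr; rewrite (Rintegral_image m13 (P := tau)).
have iD : tau.-integrable setT (EFin \o (fun z => dX z.1.1 z.2.1 + dZ z.1.2 z.2.2)).
  exact: (integrableD measurableT ix' id).
have := @coupling_test _ nu1 nu2 tau psi
  (fun z => c * (dX z.1.1 z.2.1 + dZ z.1.2 z.2.2)) M e.
move=> /(_ ctau cpsi psiM); rewrite RintegralZl// RintegralD// => H.
apply: (le_trans (H _ _)); last by rewrite lerD2l ler_wpM2l// lerD.
  exact: (integrableZl measurableT c iD).
by move=> [[x u] [y w]]; exact: psic.
Qed.

End CouplingTests.

(** * The flux of a test function *)

Section CompactSupport.
Context {R : realType}.

Lemma continuous_compact_bound (T : topologicalType) (f : T -> R) (S : set T) :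
  continuous f -> compact S -> exists2 M, 0 <= M & forall x, S x -> `|f x| <= M.
Proof.
move=> cf cS.
have /compact_bounded[M [_ HM]] : compact (f @` S).
  by apply: continuous_compact => //; exact: continuous_subspaceT.
exists (`|M| + 1) => [|x Sx]; first by rewrite addr_ge0.
by apply: HM; [rewrite (le_lt_trans (ler_norm M))// ltrDl|exists x].
Qed.

Lemma continuous_compact_support_bound (T : topologicalType) (f : T -> R)
    (S : set T) :
  continuous f -> compact S -> (forall x, ~ S x -> f x = 0) ->
  exists2 M, 0 <= M & forall x, `|f x| <= M.
Proof.
move=> cf cS fS; have [M M0 HM] := continuous_compact_bound cf cS.
exists M => // x; have [/HM//|/fS ->] := pselect (S x).
by rewrite normr0.
Qed.

Context {n : nat}.
Local Notation X := 'rV[R]_n.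

Lemma partial_continuous (g : X -> R) i : test_function g -> continuous (partial i g).
Proof. by move=> [sg _]; have [_] := sg 1%N i. Qed.

Lemma test_function_continuous (g : X -> R) : test_function g -> continuous g.
Proof. by move=> [sg _]; exact: (sg 0%N). Qed.

Lemma test_function_bound (g : X -> R) : test_function g ->
  exists2 M, 0 <= M & forall x, `|g x| <= M.
Proof.
move=> tg; apply: (continuous_compact_support_bound (test_function_continuous tg) tg.2).
move=> x Sx; apply: contrapT => gx; apply: Sx; apply: subset_closure.
exact/eqP.
Qed.

(** The complement of the support is open, so g vanishes near x. *)
Lemma partial_support (g : X -> R) i x :
  ~ closure [set x | g x != 0] x -> partial i g x = 0.
Proof.
move=> Sx; have oS : open (~` closure [set x | g x != 0]).
  exact/closed_openC/closed_closure.
have g0 y : ~ closure [set x | g x != 0] y -> g y = 0.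
  by move=> Sy; apply: contrapT => gy; apply: Sy; apply: subset_closure; exact/eqP.
rewrite /partial (@near_eq_derive _ _ _ g (cst 0)) ?derive_cst//.
near=> y; apply: g0; near: y; exact: open_nbhs_nbhs.
Unshelve. all: by end_near. Qed.

Lemma transport_integrandE (g : X -> R) z :
  transport_integrand g z = \sum_i partial i g z.1 * z.2 ord0 i.
Proof. by rewrite /transport_integrand /dotp; apply: eq_bigr => i _; rewrite mxE. Qed.

Lemma transport_integrand_continuous (g : X -> R) : test_function g ->
  continuous (transport_integrand g).
Proof.
move=> tg.
rewrite (_ : transport_integrand g =
  fun z => \sum_i partial i g z.1 * z.2 ord0 i); last first.
  by apply/funext => z; exact: transport_integrandE.
apply: continuous_sum_ord => i z; apply: cvgM.
  by apply: (@cvg_comp _ _ _ fst (partial i g)); [exact: cvg_fst|exact: partial_continuous].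
by apply: (@cvg_comp _ _ _ snd (fun v : X => v ord0 i)); [exact: cvg_snd|exact: coord_continuous].
Qed.

Context {Y : metricType R} {U : set Y} {u0 : U}.
Local Notation C := (ctrl u0).
Context (fhat : X * C -> X) (hf : dynamics_Lipschitz fhat).

(** The transport integrand read on the control side: its integral against a
    control is the integral of the transport integrand against the vector field
    of that control. *)
Definition flux (g : X -> R) (z : X * C) := transport_integrand g (dynamics fhat z).

Lemma flux_continuous g : test_function g -> continuous (flux g).
Proof.
move=> tg z; apply: (@cvg_comp _ _ _ (dynamics fhat) (transport_integrand g)).
  exact: dynamics_continuous.
exact: transport_integrand_continuous.
Qed.

Lemma flux_support g z : ~ (closure [set x | g x != 0] `*` [set: C]) z -> flux g z = 0.
Proof.
move=> Sz; rewrite /flux transport_integrandE big1// => i _.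
rewrite partial_support ?mul0r// => Sx; exact: Sz.
Qed.

Lemma flux_bound g : compact U -> test_function g ->
  exists2 M, 0 <= M & forall z, `|flux g z| <= M.
Proof.
move=> cU tg.
apply: (continuous_compact_support_bound (flux_continuous tg) _ (@flux_support g)).
by apply: compact_setX; [exact: tg.2|exact: compact_ctrl].
Qed.

(** Uniform continuity of the flux on the whole space: it vanishes for x outside
    the support of g, and the remaining arguments range over a compact set. The
    modulus therefore does not depend on the supports of the measures against
    which the flux is integrated. *)
Lemma flux_modulus g e : compact U -> test_function g -> 0 < e ->
  exists2 c, 0 <= c & forall x u y w,
    `|flux g (x, u) - flux g (y, w)| <= e + c * (eucl_dist x y + ctrl_dist u w).
Proof.
move=> cU tg e0; have [M M0 HM] := flux_bound cU tg.
have cS : compact (closure [set x | g x != 0] `*` [set: C]).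
  by apply: compact_setX; [exact: tg.2|exact: compact_ctrl].
have [||c c0 Hc] := @unif_modulus R _ (flux g) _ M
  (fun z z' => eucl_dist z.1 z'.1 + ctrl_dist z.2 z'.2) e (flux_continuous tg) cS
  (@flux_support g) HM _ _ e0.
- by move=> z z'; rewrite addr_ge0// ?eucl_dist_ge0// ctrl_dist_ge0.
- move=> [x u] [y w] r /= xr; split => /=.
    rewrite -ball_normE /= (le_lt_trans (mx_norm_le_eucl_norm _))//.
    by rewrite (le_lt_trans _ xr)// lerDl ctrl_dist_ge0.
  by apply/ball_ctrlE; rewrite (le_lt_trans _ xr)// lerDr eucl_dist_ge0.
by exists c => // x u y w; exact: (Hc (x, u) (y, w)).
Qed.

End CompactSupport.

(** * Atomic measures and lattice approximations *)

Section AtomicProbability.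
Context {R : realType} d (T : measurableType d).

Definition atomic_measure N (w : nat -> {nonneg R}) (q : nat -> T) :
    {measure set T -> \bar R} :=
  msum (fun k => mscale (w k) (@dirac d T (q k) R)) N.

Lemma atomic_measureE N w q (A : set T) :
  atomic_measure N w q A = (\sum_(k < N) (w k)%:num%:E * \d_(q k) A)%E.
Proof. by []. Qed.

(** The proof argument carries the probability structure. *)
Definition atomic_prob N w q of (atomic_measure N w q setT = 1%E) :
  set T -> \bar R := atomic_measure N w q.

Section instance.
Context N w q (w1 : atomic_measure N w q setT = 1%E).
HB.instance Definition _ := Measure.on (atomic_prob w1).
HB.instance Definition _ :=
  @Measure_isProbability.Build d T R (atomic_prob w1) w1.
End instance.

Lemma ge0_integral_atomic N w q (f : T -> R) :
  measurable_fun setT f -> (forall x, 0 <= f x) ->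
  (\int[atomic_measure N w q]_x (f x)%:E =
   \sum_(k < N) ((w k)%:num * f (q k))%:E)%E.
Proof.
move=> mf f0; have mf' : measurable_fun setT (EFin \o f) by exact/measurable_EFinP.
rewrite /atomic_measure ge0_integral_measure_sum//; last first.
  by move=> x _; rewrite lee_fin.
apply: eq_bigr => k _.
rewrite ge0_integral_mscale//; last by move=> x _; rewrite lee_fin.
rewrite integral_dirac//= diracE.
by rewrite in_setT mul1e EFinM.
Qed.

End AtomicProbability.

Section Lattice.
Context {R : realType} {n : nat}.
Local Notation X := 'rV[R]_n.

(** A lattice point is determined by the integers M x_c + N M, which lie
    between 0 and 2 N M. *)
Lemma lattice_finite (M N : nat) : (0 < M)%N ->
  finite_set (lattice (n := n) (R := R) M N).
Proof.
move=> M0; pose K := (N * M)%N.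
pose F (f : {ffun 'I_n -> 'I_(2 * K).+1}) : X :=
  \row_c (((f c : nat)%:R - K%:R) / M%:R).
apply: (@sub_finite_set _ _ (F @` [set: {ffun 'I_n -> 'I_(2 * K).+1}])); last first.
  by apply: finite_image; exact: finite_finset.
move=> x Hx.
have zP c : exists k : 'I_(2 * K).+1, x ord0 c = ((k : nat)%:R - K%:R) / M%:R.
  have [[z xz]] := Hx c.
  have M0' : 0 < M%:R :> R by rewrite ltr0n.
  rewrite xz ler_pdivlMr// ler_pdivrMr// mulNr -natrM -/K => /andP[z1 z2].
  have {}z1 : (- K%:Z <= z)%R by rewrite -(@ler_int R) mulrNz.
  have {}z2 : (z <= K%:Z)%R by rewrite -(@ler_int R).
  have kK : (`|(z + K%:Z)%R|%N < (2 * K).+1)%N by lia.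
  exists (Ordinal kK) => /=; congr (_ / _).
  have -> : (`|(z + K%:Z)%R|%N)%:R = (z + K%:Z)%:~R :> R.
    by rewrite -[LHS]/((`|(z + K%:Z)%R|%N)%:~R) gez0_abs//; lia.
  by rewrite intrD; ring.
exists [ffun c => sval (cid (zP c))] => //.
apply/rowP => c; rewrite mxE ffunE; by case: cid.
Qed.

Lemma lattice_norm (M N : nat) (x : X) : lattice M N x -> `|x| <= N%:R.
Proof.
move=> Hx; rewrite [leLHS]mx_normrE; apply: bigmax_le => // -[i c] _ /=.
by rewrite ord1 ler_norml; have [_] := Hx c.
Qed.

Lemma LAS_cell_measurable (x v : X) (r : R) :
  measurable ([set z | z.1 = x /\ cube v r z.2] : set (borel (X * X)%type)).
Proof.
have m1 c : measurable_fun setT (fun z : borel (X * X)%type => z.1 ord0 c).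
  apply: continuous_measurable_real => z.
  by apply: (@cvg_comp _ _ _ fst (fun v : X => v ord0 c)); [exact: cvg_fst|exact: coord_continuous].
have m2 c : measurable_fun setT (fun z : borel (X * X)%type => z.2 ord0 c).
  apply: continuous_measurable_real => z.
  by apply: (@cvg_comp _ _ _ snd (fun v : X => v ord0 c)); [exact: cvg_snd|exact: coord_continuous].
have -> : [set z | z.1 = x /\ cube v r z.2] = \bigcap_(c in [set: 'I_n])
    ((fun z : borel (X * X)%type => z.1 ord0 c) @^-1` [set x ord0 c] `&`
     (fun z : borel (X * X)%type => z.2 ord0 c) @^-1` `[v ord0 c, v ord0 c + r[%classic).
  apply/seteqP; split => [z [<- zc] c _|z H]; first by split => //=; rewrite in_itv/=; exact: zc.
  split; first by apply/rowP => c; have [] := H c I.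
  by move=> c; have [_] := H c I; rewrite /= in_itv.
apply: fin_bigcap_measurable => // c _; apply: measurableI.
  by rewrite -[X in measurable X]setTI; apply: m1.
by rewrite -[X in measurable X]setTI; apply: m2.
Qed.

(** The weights and atoms do not depend on the time: along a step the atoms
    x k move with velocities v k. *)
Lemma LAS_stepE N (P : 'P[R] (X * X)) : (0 < N)%N ->
  exists L (w : nat -> {nonneg R}) (x v : nat -> X),
   (forall k, (k < L)%N -> `|x k| <= N%:R /\ `|v k| <= N%:R) /\
   forall dt A, LAS_step N P dt A =
     (atomic_measure (T := borel X) L w (fun k => x k + dt *: v k)) A.
Proof.
move=> N0.
have fx : finite_set (LAS_space_grid N : set X) by apply: lattice_finite; rewrite expn_gt0 N0.
have fv : finite_set (LAS_velocity_grid N : set X) by exact: lattice_finite.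
pose s := [seq (x, v) | x <- finmap.enum_fset (fset_set (LAS_space_grid N : set X)),
  v <- finmap.enum_fset (fset_set (LAS_velocity_grid N : set X))].
have w0 p : 0 <= fine (LAS_mass N P p.1 p.2) by rewrite fine_ge0.
exists (size s), (fun k => NngNum (w0 (nth (0, 0) s k))),
  (fun k => (nth (0, 0) s k).1), (fun k => (nth (0, 0) s k).2); split.
  move=> k ks; have : nth (0, 0) s k \in s by exact: mem_nth.
  move=> /allpairsP[[x v] /= [xs vs ->]] /=.
  by split; [move: xs|move: vs]; rewrite in_fset_set// inE; exact: lattice_norm.
move=> dt A; rewrite atomic_measureE /LAS_step fsbig_finite//=.
under eq_bigr do rewrite fsbig_finite//=.
pose G (p : X * X) : \bar R :=
  ((fine (LAS_mass N P p.1 p.2))%:E * \d_((p.1 + dt *: p.2)%R : borel X) A)%E.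
rewrite -(big_mkord xpredT (fun k => G (nth (0, 0) s k))) -(big_nth (0, 0) xpredT G).
rewrite big_allpairs_dep/=; apply: eq_bigr => x _; apply: eq_bigr => v _.
by rewrite /G /= fineK// fin_num_measure//; exact: LAS_cell_measurable.
Qed.

End Lattice.

Section Support.
Context {R : realType}.

Lemma spt_closed (T : ptopologicalType) (mu : 'P[R] T) : closed (spt mu).
Proof.
move=> x cx A oA Ax; have [y [sy Ay]] := cx A (open_nbhs_nbhs (conj oA Ax)).
exact: sy.
Qed.

Lemma spt_subclosed (T : ptopologicalType) (mu : 'P[R] T) (K : set T) :
  closed K -> mu (~` K) = 0%E -> spt mu `<=` K.
Proof.
move=> cK mK x sx; apply: contrapT => Kx.
by have := sx _ (closed_openC cK) Kx; rewrite mK ltxx.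
Qed.

Lemma compactly_supported_sub (T : ptopologicalType) (mu : 'P[R] T) (K : set T) :
  compact K -> spt mu `<=` K -> compactly_supported mu.
Proof. by move=> cK sK; exact: subclosed_compact (@spt_closed _ _) cK sK. Qed.

End Support.

Section LASContinuity.
Context {R : realType} {n : nat}.
Local Notation X := 'rV[R]_n.

(** Couple the k-th atom of m1 with the k-th atom of m2. *)
Lemma W1_atomic (L : nat) (w : nat -> {nonneg R}) (q1 q2 : nat -> X)
    (m1 m2 : 'P[R] X) (B : R) :
  (forall A, measurable A -> m1 A = atomic_measure (T := borel X) L w q1 A) ->
  (forall A, measurable A -> m2 A = atomic_measure (T := borel X) L w q2 A) ->
  (forall k, (k < L)%N -> eucl_dist (q1 k) (q2 k) <= B) ->
  (W1 m1 m2 <= B%:E)%E.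
Proof.
move=> m1E m2E dB.
have w1 : atomic_measure (T := borel (X * X)%type) L w (fun k => (q1 k, q2 k)) setT = 1%E.
  have := m1E _ measurableT; rewrite probability_setT !atomic_measureE => ->.
  by apply: eq_bigr => k _; rewrite !diracT.
pose tau : 'P[R] (X * X) := atomic_prob w1.
apply: ge_ereal_inf; exists (transport_cost eucl_dist tau).
  exists tau => //; split => A mA.
    exact/esym/m1E.
  exact/esym/m2E.
have mE : measurable_fun setT (fun z : borel (X * X)%type => eucl_dist z.1 z.2).
  apply: continuous_measurable_real.
  by apply: continuous_eucl_dist; [exact: fst_cont|exact: snd_cont].
rewrite /transport_cost ge0_integral_atomic//; last by move=> z; exact: eucl_dist_ge0.
apply: (@le_trans _ _ (\sum_(k < L) ((w k)%:num * B)%:E)%E).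
  by apply: lee_sum => k _; rewrite lee_fin ler_wpM2l// dB.
rewrite sumEFin -mulr_suml.
suff -> : \sum_(i < L) (w i)%:num = 1 :> R by rewrite mul1r.
apply: EFin_inj; rewrite -sumEFin -[RHS]w1 atomic_measureE.
by apply: eq_bigr => k _; rewrite diracT mule1.
Qed.

Lemma atomic_compactly_supported (L : nat) (w : nat -> {nonneg R}) (q : nat -> X)
    (m : 'P[R] X) (B : R) :
  (forall A, measurable A -> m A = atomic_measure (T := borel X) L w q A) ->
  (forall k, (k < L)%N -> `|q k| <= B) -> compactly_supported m.
Proof.
move=> mE qB; pose K := [set x : X | `|x| <= B].
have cK : closed K.
  have /preimage_closed := @closed_le R B; apply => x _.
  exact: norm_continuous.
apply: (@compactly_supported_sub _ _ _ K).
  apply: bounded_closed_compact => //; exists B; split; first exact: num_real.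
  by move=> B' BB' x /= xB; rewrite (le_trans xB)// ltW.
apply: spt_subclosed => //.
rewrite mE; last by apply: open_borel_measurable; exact: closed_openC.
rewrite atomic_measureE big1// => k _; rewrite diracE memNset ?mule0//.
by move=> /=; apply; exact: qB.
Qed.

Lemma LAS_step_W1 N (P : 'P[R] (X * X)) (m1 m2 : 'P[R] X) (t1 t2 : R) :
  (0 < N)%N ->
  (forall A, measurable A -> m1 A = LAS_step N P t1 A) ->
  (forall A, measurable A -> m2 A = LAS_step N P t2 A) ->
  [/\ compactly_supported m1, compactly_supported m2 &
   (W1 m1 m2 <= (n%:R * N%:R * `|t1 - t2|)%:E)%E].
Proof.
move=> N0 m1E m2E; have [L [w [x [v [xv stepE]]]]] := LAS_stepE P N0.
have cs (m : 'P[R] X) (t : R) : (forall A, measurable A -> m A = LAS_step N P t A) ->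
    compactly_supported m.
  move=> mE; apply: (@atomic_compactly_supported L w (fun k => x k + t *: v k)
    m (N%:R + `|t| * N%:R)).
    by move=> A /mE ->.
  move=> k /xv[xN vN]; rewrite (le_trans (ler_normD _ _))// lerD//.
  by rewrite normrZ ler_wpM2l.
split; [exact: cs m1E|exact: cs m2E|].
apply: (@W1_atomic L w (fun k => x k + t1 *: v k) (fun k => x k + t2 *: v k)).
- by move=> A /m1E ->.
- by move=> A /m2E ->.
move=> k /xv[xN vN]; rewrite /eucl_dist (le_trans (eucl_norm_le_mx_norm _))//.
rewrite -mulrA ler_wpM2l//.
have -> : x k + t1 *: v k - (x k + t2 *: v k) = (t1 - t2) *: v k.
  by rewrite opprD addrACA subrr add0r -scalerBl.
by rewrite normrZ mulrC ler_wpM2r.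
Qed.

End LASContinuity.

(** * Lipschitz functions and supports of measures *)

Section SetDistance.
Context {R : realType} {n : nat}.
Local Notation X := 'rV[R]_n.
Implicit Types (A C : set X) (x y : X).

(** The distance for the supremum norm: it is 1-Lipschitz for that norm, hence
    for the Euclidean distance, which dominates it. *)
Definition set_dist C x : R := inf [set `|x - z| | z in C].

Let has_lb C x : has_lbound [set `|x - z| | z in C].
Proof. by exists 0 => _ [z _ <-]. Qed.

Lemma set_dist_ge0 C x : C !=set0 -> 0 <= set_dist C x.
Proof.
by move=> [z Cz]; apply: lb_le_inf; [exists `|x - z|, z|move=> _ [w _ <-]].
Qed.

Lemma set_dist0 C x : C !=set0 -> C x -> set_dist C x = 0.
Proof.
move=> C0 Cx; apply/eqP; rewrite eq_le set_dist_ge0// andbT.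
by apply: ge_inf => //; exists x => //; rewrite subrr normr0.
Qed.

Lemma set_dist_le C x y : C !=set0 -> set_dist C x <= set_dist C y + `|x - y|.
Proof.
move=> [z0 Cz0]; rewrite -lerBlDr; apply: lb_le_inf; first by exists `|y - z0|, z0.
move=> _ [z Cz <-]; rewrite lerBlDr (@le_trans _ _ `|x - z|)//.
  by apply: ge_inf => //; exists z.
by rewrite [leRHS]addrC ler_distD.
Qed.

Lemma set_dist_gt0 C x : closed C -> C !=set0 -> ~ C x -> 0 < set_dist C x.
Proof.
move=> cC C0 Cx; have /nbhs_ballP[e /= e0 He] : nbhs x (~` C).
  by apply: open_nbhs_nbhs; split => //; exact: closed_openC.
apply: lt_le_trans e0 _; case: C0 => z0 Cz0.
apply: lb_le_inf; first by exists `|x - z0|, z0.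
move=> _ [z Cz <-]; rewrite leNgt; apply/negP => xz.
by apply: (He z) => //; rewrite -ball_normE.
Qed.

(** The functions min (1, (j + 1) d(x, complement of A)). Tests against them are
    continuous for W1 and recover the measure of A in the limit. *)
Lemma open_lipschitz_approx A : open A -> exists phi : nat -> X -> R,
  [/\ forall j, continuous (phi j),
      forall j x, 0 <= phi j x <= 1,
      forall j, exists2 c, 0 <= c & forall x y, `|phi j x - phi j y| <= c * eucl_dist x y,
      forall j x, ~ A x -> phi j x = 0 &
      forall x, A x -> phi j x @[j --> \oo] --> (1 : R)].
Proof.
move=> oA; have [[z0 Az0]|A0] := pselect (~` A !=set0); last first.
  have AT x : A x by apply: contrapT => Ax; apply: A0; exists x.
  exists (fun _ _ => 1); split => [j x|j x|j|j x /(_ (AT x))//|x _].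
  - exact: (@cst_continuous _ _ (1 : R)).
  - by rewrite ler01 lexx.
  - by exists 0 => // x y; rewrite subrr normr0 mul0r.
  - exact: cvg_cst.
have C0 : ~` A !=set0 by exists z0.
have cC : closed (~` A) by exact: open_closedC.
pose phi j x := Num.min 1 (j.+1%:R * set_dist (~` A) x).
have phi_lip j x y : `|phi j x - phi j y| <= j.+1%:R * `|x - y|.
  wlog : x y / phi j y <= phi j x.
    by move=> H; have [/H//|/ltW/H] := leP (phi j y) (phi j x); rewrite distrC (distrC y).
  move=> xy; rewrite ger0_norm ?subr_ge0// lerBlDr addrC.
  have le1 : j.+1%:R * set_dist (~` A) x <=
      j.+1%:R * set_dist (~` A) y + j.+1%:R * `|x - y|.
    by rewrite -mulrDr ler_wpM2l// set_dist_le.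
  have j0 : 0 <= j.+1%:R * `|x - y| by rewrite mulr_ge0.
  rewrite /phi; have [_|_] := leP 1 (j.+1%:R * set_dist (~` A) y).
    by rewrite (@le_trans _ _ 1)// ?ge_min ?lexx// lerDl.
  by rewrite (le_trans _ le1)// ge_min lexx orbT.
exists phi; split.
- move=> j x; suff : phi j y @[y --> x] --> phi j x by [].
  have FF : Filter (nbhs (x : X)) := nbhs_filter x.
  apply/(@cvgrPdist_lt R R^o X (nbhs (x : X)) FF) => e e0; apply/nbhs_ballP.
  exists (e / j.+1%:R) => [|y]; first by rewrite /= divr_gt0.
  by rewrite -ball_normE/= ltr_pdivlMr// mulrC; apply: le_lt_trans (phi_lip _ _ _).
- move=> j x; rewrite /phi ge_min lexx/= andbT le_min ler01 mulr_ge0//.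
  exact: set_dist_ge0.
- move=> j; exists j.+1%:R => // x y; rewrite (le_trans (phi_lip _ _ _))//.
  by rewrite ler_wpM2l// mx_norm_le_eucl_norm.
- by move=> j x Ax; rewrite /phi set_dist0// mulr0 min_r.
- move=> x Ax; have d0 : 0 < set_dist (~` A) x by apply: set_dist_gt0 => //; exact.
  apply: cvg_near_cst; near=> j; rewrite /phi min_l//.
  have : (set_dist (~` A) x)^-1 <= j.+1%:R.
    rewrite (@le_trans _ _ j%:R)// ?ler_nat//; near: j; exact: nbhs_infty_ger.
  by rewrite -[_^-1]mul1r ler_pdivrMr.
Unshelve. all: by end_near. Qed.

Lemma open_approx_cvg A (phi : nat -> X -> R) (m : 'P[R] X) : open A ->
  (forall j, continuous (phi j)) -> (forall j x, 0 <= phi j x <= 1) ->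
  (forall j x, ~ A x -> phi j x = 0) ->
  (forall x, A x -> phi j x @[j --> \oo] --> (1 : R)) ->
  (\int[m]_x (phi j x)%:E)%E @[j --> \oo] --> m A.
Proof.
move=> oA cphi phi01 phi0 phi1.
have mA := open_borel_measurable oA.
rewrite -[A in m A]setIT -(integral_indic m measurableT mA).
apply: (@dominated_cvg _ _ _ m setT measurableT _ _ (cst 1%E)) => //.
- by move=> j; apply/measurable_EFinP; exact: (continuous_measurable_real (cphi j)).
- move=> x _; apply: cvg_EFin; first exact: nearW.
  rewrite (_ : _ \o _ = phi ^~ x)// indicE.
  have [Ax|Ax] := pselect (A x); first by rewrite mem_set//; exact: phi1.
  rewrite memNset//; apply: cvg_near_cst; apply: nearW => j; exact: phi0.
- exact: finite_measure_integrable_cst.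
- by move=> j x _; have /andP[p0 p1] := phi01 j x; rewrite /= lee_fin ger0_norm.
Qed.

(** Open sets form a pi-system generating the Borel sets. *)
Lemma lipschitz_determines (m1 m2 : 'P[R] X) :
  (forall (phi : X -> R) (c : R), continuous phi ->
    (forall x, 0 <= phi x <= 1) -> 0 <= c ->
    (forall x y, `|phi x - phi y| <= c * eucl_dist x y) ->
    \int[m1]_x phi x = \int[m2]_x phi x) -> m1 ≡μ m2.
Proof.
move=> H; apply: (measure_unique (@open X : set (set (borel X))) (fun=> setT)) => //.
- by move=> A B; exact: openI.
- by move=> _; exact: openT.
- by rewrite bigcup_const.
- move=> A oA; have [phi [cphi phi01 phiL phi0 phi1]] := open_lipschitz_approx oA.
  have c1 := open_approx_cvg (m := m1) oA cphi phi01 phi0 phi1.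
  have c2 := open_approx_cvg (m := m2) oA cphi phi01 phi0 phi1.
  suff E : (fun j => \int[m1]_x (phi j x)%:E)%E = (fun j => \int[m2]_x (phi j x)%:E)%E.
    by rewrite E in c1; exact: (cvg_unique _ c1 c2).
  apply/funext => j; have [c c0 Hc] := phiL j.
  have bnd x : `|phi j x| <= 1 by have /andP[? ?] := phi01 j x; rewrite ger0_norm.
  have fin (m : 'P[R] X) : (\int[m]_x (phi j x)%:E)%E \is a fin_num.
    apply: integrable_fin_num => //.
    exact: (continuous_bounded_integrable _ (cphi j) bnd).
  rewrite -(fineK (fin m1)) -(fineK (fin m2)); congr EFin.
  exact: (H _ _ (cphi j) (phi01 j) c0 Hc).
- by move=> _; rewrite (le_lt_trans (probability_le1 m1 _))// ltry.
Qed.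

(** The complement of K is a countable union of compact sets D j, so it is
    enough that a compact set D disjoint from the support is null. *)
Lemma spt_null (m : 'P[R] X) (K : set X) : compact K -> spt m `<=` K ->
  m (~` K) = 0%E.
Proof.
move=> cK sK; have clK : closed K by apply: compact_closed cK; exact: norm_hausdorff.
have oK := closed_openC clK.
pose D (j : nat) : set X := [set x | `|x| <= j%:R] `&`
  \bigcap_(z in K) [set x | j.+1%:R^-1 <= `|x - z|].
have cD j : compact (D j).
  apply: bounded_closed_compact.
    exists j%:R; split; first exact: num_real.
    by move=> r jr x [/= xj _]; rewrite (le_trans xj)// ltW.
  apply: closedI.
    apply: (@preimage_closed X R Num.norm _ _ (@closed_le R j%:R)) => x _.
    exact: norm_continuous.
  apply: closed_bigI => z _.
  apply: (@preimage_closed X R (fun x : X => `|x - z|) _ _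
    (@closed_ge R j.+1%:R^-1)) => x _.
  apply: (@continuous_comp _ _ _ (fun x : X => x - z) Num.norm).
    by apply: (@continuousB _ _ _ idfun (cst z)); [by move=> ? ?|exact: cst_continuous].
  exact: norm_continuous.
have KD : ~` K = \bigcup_j D j.
  apply/seteqP; split => [x Kx|x [j _ [_ Dx]] Kx]; last first.
    by have := Dx x Kx; rewrite /= subrr normr0 leNgt invr_gt0 ltr0n.
  have /nbhs_ballP[e /= e0 He] : nbhs x (~` K) by exact: open_nbhs_nbhs.
  pose j := (Num.Def.trunc (`|x| + e^-1)).+1.
  have je : `|x| + e^-1 < j%:R by exact: truncnS_gt.
  have ei0 : 0 < e^-1 by rewrite invr_gt0.
  exists j => //; split => /=; first by have := normr_ge0 x; lra.
  move=> z Kz /=; rewrite leNgt; apply/negP => xz; apply: (He z) => //.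
  rewrite -ball_normE /= (lt_trans xz)// -[ltRHS]invrK ltf_pV2// ?posrE//.
  rewrite -natr1; have := normr_ge0 x; lra.
(* Near covering of D by the filter of almost everywhere properties: each point
   of D has a null neighbourhood, so that almost every y avoids all points of D
   near it, hence almost every y avoids D. *)
have D0 j : m.-negligible (D j).
  have FF : Filter (almost_everywhere m) by apply: ae_filter_ringOfSetsType.
  have /compact_near_coveringP/(_ _ (almost_everywhere m) (fun y x => y <> x) FF) := cD j.
  have H x : D j x -> \forall x' \near x & y \near almost_everywhere m, y <> x'.
    move=> [_ Dx].
    have nsx : ~ spt m x.
      by move=> /sK Kx; have := Dx x Kx; rewrite /= subrr normr0 leNgt invr_gt0 ltr0n.
    have [A [oA Ax mA]] : exists A, [/\ open A, A x & m A = 0%E].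
      apply: contrapT => nA; apply: nsx => A oA Ax.
      rewrite lt0e measure_ge0 andbT; apply/negP => /eqP mA0; apply: nA.
      by exists A.
    exists (A, ~` A) => /=.
      split; first exact: open_nbhs_nbhs.
      exists A; split => //; first exact: open_borel_measurable.
      by move=> y /= ?; exact: contrapT.
    by move=> [x' y] /= [Ax' nAy] yx; apply: nAy; rewrite yx.
  move=> /(_ H); apply: negligibleS => x Dx /=; apply => //; exact: Dx.
apply/negligibleP; first exact: open_borel_measurable.
rewrite KD; exact: negligible_bigcup.
Qed.

End SetDistance.

(** * Mean flux of a control and barycentric vector fields *)

Section LipschitzControls.
Context {R : realType} {n : nat} {Y : metricType R} {U : set Y} {u0 : U}.
Local Notation X := 'rV[R]_n.
Context (compactU : compact U).
Context (fhat : X * ctrl u0 -> X) (hf : dynamics_Lipschitz fhat).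
Context (u : nat -> 'P[R] X -> 'P[R] (X * ctrl u0)).
Hypothesis control_u : forall k, measure_control (u k).
Hypothesis lip_u : uniformly_W_Lipschitz u.

Definition mean_flux g k (m : 'P[R] X) : R := \int[u k m]_z flux fhat g z.

Lemma mean_flux_measure_eq g k (m1 m2 : 'P[R] X) :
  m1 ≡μ m2 -> mean_flux g k m1 = mean_flux g k m2.
Proof. by move=> m12; apply: Rintegral_measure_eq; exact: (control_u k).1. Qed.

Lemma mean_flux_bound g : test_function g ->
  exists2 M, 0 <= M & forall k m, `|mean_flux g k m| <= M.
Proof.
move=> tg; have [M M0 HM] := flux_bound hf compactU tg.
exists M => // k m; apply: le_norm_Rintegral_bound => //.
exact: (continuous_bounded_integrable _ (flux_continuous hf tg) HM).
Qed.

Lemma control_field_integral g k m : test_function g ->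
  \int[control_field hf (u k) m]_z transport_integrand g z = mean_flux g k m.
Proof.
move=> tg; have [M M0 HM] := flux_bound hf compactU tg.
rewrite (Rintegral_image (P := u k m)
  (continuous_measurable_borel (dynamics_continuous hf)))//.
  exact: (continuous_measurable_real (transport_integrand_continuous tg)).
exact: (continuous_bounded_integrable _ (flux_continuous hf tg) HM).
Qed.

(** Test the flux against a plan between the two controls given by the
    Lipschitz condition: its X-cost is W1 m1 m2 < d, its control cost is at most
    L d + d. *)
Lemma mean_flux_modulus g e : test_function g -> 0 < e ->
  exists2 d, 0 < d & forall k m1 m2, compactly_supported m1 ->
    compactly_supported m2 -> (W1 m1 m2 < d%:E)%E ->
    `|mean_flux g k m1 - mean_flux g k m2| <= e.
Proof.
move=> tg e0; have e20 : 0 < e / 2 by rewrite divr_gt0.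
have [M M0 HM] := flux_bound hf compactU tg.
have [c c0 Hc] := flux_modulus hf compactU tg e20.
have [L L0 HL] := lip_u.
pose b := (c + 1) * (L + 2).
have b0 : 0 < b by rewrite /b mulr_gt0//; lra.
exists (e / 2 / b) => [|k m1 m2 c1 c2 W12]; first by rewrite divr_gt0.
set d := e / 2 / b in W12 *.
have d0 : 0 < d by rewrite divr_gt0.
have e1 := (control_u k).2 m1; have e2 := (control_u k).2 m2.
have h1 : (W1 (marginal1 (u k m1)) (marginal1 (u k m2)) <= d%:E)%E.
  by rewrite /W1 (wasserstein_measure_eq _ e1 e2) ltW.
have h2 : (wasserstein_pseudo eucl_dist (@ctrl_dist R Y U u0) (u k m1) (u k m2)
    < (L * d + d)%:E)%E.
  apply: (le_lt_trans (HL k m1 m2 c1 c2)).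
  apply: (@le_lt_trans _ _ (L%:E * d%:E)%E); first by rewrite lee_wpmul2l ?lee_fin ?ltW.
  by rewrite -EFinM lte_fin ltrDl.
have := wasserstein_pseudo_test
  (continuous_eucl_dist (@fst_cont X X) (@snd_cont X X)) (@eucl_dist_ge0 R n)
  (continuous_ctrl_dist (@fst_cont _ _) (@snd_cont _ _)) (@ctrl_dist_ge0 R Y U u0)
  (flux_continuous hf tg) HM c0 Hc h1 h2.
move=> /le_trans; apply.
have eE : e = e / 2 + b * d by rewrite /d; field; exact: lt0r_neq0.
rewrite [leRHS]eE lerD2l /b (_ : d + (L * d + d) = (L + 2) * d); last ring.
rewrite mulrA ler_wpM2r ?(ltW d0)// ler_wpM2r//; lra.
Qed.

Section Barycentric.
Context (K : set X) (compactK : compact K).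
Context (F : set_system nat) {UF : UltraFilter F}.

(** The image of m under the graph of b, where b is the limit barycentre of the
    velocities. It has the right integrals because the transport integrand is
    linear in the velocity. *)
Lemma barycentric_field (m : 'P[R] X) : m (~` K) = 0%E ->
  exists nu : 'P[R] (X * X), marginal1 nu ≡μ m /\
   forall g, test_function g ->
    nu.-integrable setT (EFin \o transport_integrand g) /\
    mean_flux g k m @[k --> F] --> \int[nu]_z transport_integrand g z.
Proof.
move=> mK.
have cfhat : continuous fhat.
  move=> z; apply: (@cvg_comp _ _ _ (dynamics fhat) snd); first exact: dynamics_continuous.
  exact: cvg_snd.
have cfi i : continuous (fun z => fhat z ord0 i).
  by move=> z; apply: (@cvg_comp _ _ _ fhat (fun v : X => v ord0 i));
    [exact: cfhat|exact: coord_continuous].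
have [B B0 HB] : exists2 B, 0 <= B & forall z, (K `*` [set: ctrl u0]) z -> `|fhat z| <= B.
  have cn : continuous (fun z => `|fhat z|).
    by move=> z; apply: (@cvg_comp _ _ _ fhat Num.norm); [exact: cfhat|exact: norm_continuous].
  have cKC := compact_setX compactK (compact_ctrl (u0 := u0) compactU).
  have [B B0 HB] := continuous_compact_bound cn cKC.
  by exists B => // z /HB; rewrite normr_id.
(* The velocity is truncated at its bound B over K, which changes it only on a
   null set and makes it bounded everywhere. *)
pose q i z := Num.max (- B) (Num.min B (fhat z ord0 i)).
have cq i : continuous (q i).
  move=> z; apply: max_fun_continuous; first exact: cst_continuous.
  by move=> {}z; apply: min_fun_continuous; [exact: cst_continuous|exact: cfi].
have qB i z : `|q i z| <= B.
  by rewrite ler_norml /q le_max lexx/= ge_max ge_min lexx andbT; lra.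
have qE i z : K z.1 -> q i z = fhat z ord0 i.
  move=> Kz; have : `|fhat z ord0 i| <= B.
    apply: le_trans (HB z (conj Kz I)); rewrite [leRHS]mx_normrE.
    exact: (le_bigmax _ (fun ij : 'I_1 * 'I_n => `|fhat z ij.1 ij.2|) (ord0, i)).
  by rewrite ler_norml => /andP[? ?]; rewrite /q min_r// max_r.
have mfst := continuous_measurable_borel (@fst_cont X (ctrl u0)).
have PE k (A : set (borel X)) : measurable A -> u k m (fst @^-1` A) = m A.
  by move=> mA; exact: (control_u k).2.
have mKc : measurable (~` K : set (borel X)).
  apply: open_borel_measurable; apply: closed_openC.
  by apply: compact_closed compactK; exact: norm_hausdorff.
have [b Hb] := choice (fun i => @setwise_barycenter _ _ _ m _ _ (fun k => u k m)
  fst mfst PE (q i) (continuous_measurable_real (cq i)) B (qB i) F UF).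
pose gr (x : borel X) : borel (X * X)%type := (x, \row_i b i x).
have mgr : measurable_fun setT gr.
  apply: (@measurable_fun_prod_rV R n _ (borel X) id (fun x => \row_i b i x)) => i.
    by apply: (continuous_measurable_real (T := X)); exact: coord_continuous.
  rewrite (_ : (fun x => _) = b i); first by have [] := Hb i.
  by apply/funext => x; rewrite mxE.
pose gr' : {mfun borel X >-> borel (X * X)%type} := mfun_Sub (mem_set mgr).
pose nu : 'P[R] (X * X) := distribution m gr'.
exists nu; split; first by move=> A mA.
move=> g tg.
have tgr x : transport_integrand g (gr x) = \sum_i partial i g x * b i x.
  by rewrite transport_integrandE; apply: eq_bigr => i _; rewrite mxE.
have pB i : exists2 C, 0 <= C & forall x, `|partial i g x| <= C.
  have [sg cg] := tg.
  apply: (continuous_compact_support_bound (@partial_continuous _ _ g i tg) cg) => x.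
  exact: partial_support.
have mp i : measurable_fun [set: borel X] (partial i g).
  by apply: (@continuous_measurable_real R X); exact: partial_continuous.
have ip i : m.-integrable setT (EFin \o (fun x => partial i g x * b i x)).
  have [C C0 HC] := pB i; have [_ bi _] := Hb i.
  apply: (integrableMr measurableT (mp i) _ bi).
  by exists C; split=> [|C' CC' x _]; rewrite ?num_real//= (le_trans (HC x)) ?ltW.
have igr : m.-integrable setT (EFin \o (transport_integrand g \o gr)).
  rewrite (_ : _ \o _ = fun x => (\sum_i (partial i g x * b i x)%:E)%E).
    by apply: integrable_sum => // i _; exact: ip.
  by apply/funext => x /=; rewrite tgr -sumEFin.
have mt := continuous_measurable_real (transport_integrand_continuous tg).
have QE A : measurable A -> nu A = m (gr @^-1` A) by [].
split; first exact: (integrable_image mgr QE mt igr).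
rewrite (Rintegral_image mgr QE mt igr).
have -> : \int[m]_x transport_integrand g (gr x) =
    \sum_i \int[m]_x (partial i g x * b i x).
  under eq_Rintegral do rewrite tgr.
  by have [_] := Rintegral_sum ip.
(* The flux and its truncated version differ only over the complement of K. *)
have fE k : mean_flux g k m = \sum_i \int[u k m]_z (partial i g z.1 * q i z).
  have cpq i : continuous (fun z : X * ctrl u0 => partial i g z.1 * q i z).
    move=> z; apply: cvgM; last exact: cq.
    by apply: (@cvg_comp _ _ _ fst (partial i g)); [exact: cvg_fst|exact: partial_continuous].
  have ipq i : (u k m).-integrable setT (EFin \o (fun z => partial i g z.1 * q i z)).
    have [C C0 HC] := pB i; apply: (@continuous_bounded_integrable _ _ _ _ (C * B)) => //.
    by move=> z; rewrite normrM ler_pM.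
  have [iS <-] := Rintegral_sum ipq.
  rewrite /mean_flux /Rintegral; congr fine; apply: ae_eq_integral => //.
  - apply/measurable_EFinP; exact: (continuous_measurable_real (flux_continuous hf tg)).
  - exact: measurable_int iS.
  - exists (fst @^-1` (~` K)); split.
    + by rewrite -[X in measurable X]setTI; apply: mfst.
    + by rewrite -[RHS]mK; exact: PE.
    + move=> z nz Kz; apply: nz => _ /=; congr EFin.
      rewrite /flux transport_integrandE; apply: eq_bigr => i _.
      by rewrite /dynamics /= qE.
under eq_fun do rewrite fE.
apply: cvg_big => [|i _]; first exact: add_continuous.
have [_ _ H] := Hb i; have [C C0 HC] := pB i.
exact: (H (partial i g) C).
Qed.

End Barycentric.
End LipschitzControls.

(** * Convergence of test integrals *)

Section UniformLimit.
Context {R : realType} {n : nat}.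
Local Notation X := 'rV[R]_n.

Lemma W1_sup_near (S : set R) (a b : nat -> R -> 'P[R] X) :
  ereal_sup [set W1 (a k t) (b k t) | t in S] @[k --> \oo] --> 0%E ->
  forall d, 0 < d -> \forall k \near \oo, forall t, S t ->
    (W1 (a k t) (b k t) < d%:E)%E.
Proof.
move=> H d d0.
have : \forall k \near \oo, (ereal_sup [set W1 (a k t) (b k t) | t in S] < d%:E)%E.
  by have /H := @open_ereal_lt' R 0%E d%:E d0.
apply: filterS => k Hk t St; apply: le_lt_trans Hk.
by apply: ereal_sup_ubound; exists t.
Qed.

Lemma W1_null_cvg (phi : X -> R) (M : R) (a : nat -> 'P[R] X) (b : 'P[R] X) :
  continuous phi -> (forall x, `|phi x| <= M) ->
  (forall e : R, 0 < e -> exists2 c, 0 <= c &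
    forall x y, `|phi x - phi y| <= e + c * eucl_dist x y) ->
  (forall d, 0 < d -> \forall k \near \oo, (W1 (a k) b < d%:E)%E) ->
  \int[a k]_x phi x @[k --> \oo] --> \int[b]_x phi x.
Proof.
move=> cphi phiM phic ab; apply/cvgrPdist_le => e e0.
have e20 : 0 < e / 2 by rewrite divr_gt0.
have [c' c0 Hc] := phic _ e20.
have d0 : 0 < e / 2 / (c' + 1) by rewrite divr_gt0//; lra.
apply: filterS (ab _ d0) => k Wk; rewrite distrC.
rewrite (le_trans (W1_test cphi phiM c0 Hc Wk))// [leRHS](splitr e) lerD2l.
rewrite mulrCA ger_pMr// ler_pdivrMr; lra.
Qed.

Lemma test_function_modulus (g : X -> R) e : test_function g -> 0 < e ->
  exists2 c, 0 <= c & forall x y, `|g x - g y| <= e + c * eucl_dist x y.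
Proof.
move=> tg e0; have [M M0 HM] := test_function_bound tg; have [_ cg] := tg.
apply: (@unif_modulus R X g _ M _ e (test_function_continuous tg) cg _ HM) => //.
- by move=> x Sx; apply: contrapT => gx; apply: Sx; apply: subset_closure; exact/eqP.
- exact: eucl_dist_ge0.
- move=> x y r xr; rewrite -ball_normE /=.
  by rewrite (le_lt_trans (mx_norm_le_eucl_norm _)).
Qed.

End UniformLimit.

(** * The limit curve *)

Section LimitCurve.
Context {R : realType} {n : nat} {Y : metricType R} {U : set Y} {u0 : U}.
Local Notation X := 'rV[R]_n.
Context (compactU : compact U).
Context (fhat : X * ctrl u0 -> X) (hf : dynamics_Lipschitz fhat).
Context (mubar : 'P[R] X) (K : set X) (compactK : compact K).
Context (u : nat -> 'P[R] X -> 'P[R] (X * ctrl u0)).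
Hypothesis control_u : forall k, measure_control (u k).
Hypothesis lip_u : uniformly_W_Lipschitz u.
Context (muk : nat -> R -> 'P[R] X).
Hypothesis sol_muk : forall k, solution (control_field hf (u k)) mubar (muk k).
Hypothesis LAS_muk : forall k, limit_of_LAS (control_field hf (u k)) mubar (muk k).
Hypothesis muk_K : forall k t, 0 <= t -> spt (muk k t) `<=` K.
Context (mu : R -> 'P[R] X).
Hypothesis cvg_mu :
  ereal_sup [set W1 (muk k t) (mu t) | t in [set t | 0 <= t]] @[k --> \oo] --> 0%E.

Let H := mean_flux fhat u.

Lemma muk_near_mu d : 0 < d ->
  \forall k \near \oo, forall t, 0 <= t -> (W1 (muk k t) (mu t) < d%:E)%E.
Proof. exact: (W1_sup_near cvg_mu). Qed.

Lemma muk_cvg (phi : X -> R) (M : R) t : continuous phi -> (forall x, `|phi x| <= M) ->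
  (forall e : R, 0 < e -> exists2 c, 0 <= c &
    forall x y, `|phi x - phi y| <= e + c * eucl_dist x y) ->
  0 <= t -> \int[muk k t]_x phi x @[k --> \oo] --> \int[mu t]_x phi x.
Proof.
move=> cphi phiM phic t0; apply: (W1_null_cvg cphi phiM phic) => d d0.
by apply: filterS (muk_near_mu d0) => k; apply.
Qed.

Let closedK : closed K.
Proof. by apply: compact_closed compactK; exact: norm_hausdorff. Qed.

(** The Lipschitz functions that approximate the indicator of the complement of
    K have integral 0 against every muk k t, hence against mu t. *)
Lemma mu_off_K t : 0 <= t -> mu t (~` K) = 0%E.
Proof.
move=> t0; have oK := closed_openC closedK.
have [phi [cphi phi01 phiL phi0 phi1]] := open_lipschitz_approx oK.
have phiM j x : `|phi j x| <= 1 by have /andP[? ?] := phi01 j x; rewrite ger0_norm.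
have E j : (\int[mu t]_x (phi j x)%:E = 0)%E.
  have c1 : \int[muk k t]_x phi j x @[k --> \oo] --> \int[mu t]_x phi j x.
    apply: (muk_cvg (cphi j) (phiM j)) => // e e0; have [c c0 Hc] := phiL j.
    by exists c => // x y; rewrite (le_trans (Hc x y))// lerDr ltW.
  have E0 k : \int[muk k t]_x phi j x = 0.
    rewrite /Rintegral (_ : (\int[muk k t]_x (phi j x)%:E)%E = 0%E)//.
    rewrite -(integral0 (muk k t) setT); apply: ae_eq_integral => //.
      by apply/measurable_EFinP; exact: (continuous_measurable_real (cphi j)).
    exists (~` K); split.
    - exact: open_borel_measurable.
    - exact: spt_null compactK (muk_K t0).
    - move=> x nx Kx; apply: nx => _ /=; rewrite phi0//; exact.
  have {}E0 : (fun k => \int[muk k t]_x phi j x) = cst 0 by apply/funext.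
  rewrite E0 in c1.
  have c0 : cst (0 : R) k @[k --> \oo] --> (0 : R) by exact: cvg_cst.
  have fin : (\int[mu t]_x (phi j x)%:E)%E \is a fin_num.
    apply: integrable_fin_num => //.
    exact: (continuous_bounded_integrable _ (cphi j) (phiM j)).
  by rewrite -(fineK fin); congr EFin; exact: (cvg_unique (@Rhausdorff R) c1 c0).
have := open_approx_cvg (m := mu t) oK cphi phi01 phi0 phi1.
rewrite (_ : (fun j => _) = cst 0%E); last by apply/funext.
move=> c1; have c0 : cst (0%E : \bar R) k @[k --> \oo] --> (0%E : \bar R).
  exact: cvg_cst.
exact: (cvg_unique _ c1 c0).
Qed.

Lemma mu_compactly_supported t : 0 <= t -> compactly_supported (mu t).
Proof.
move=> t0; apply: compactly_supported_sub compactK _.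
by apply: spt_subclosed; [exact: closedK|exact: mu_off_K].
Qed.

Lemma muk_compactly_supported k t : 0 <= t -> compactly_supported (muk k t).
Proof. by move=> t0; apply: compactly_supported_sub compactK _; exact: muk_K. Qed.

Lemma mu_initial : mu 0 ≡μ mubar.
Proof.
apply: lipschitz_determines => phi c cphi phi01 c0 phic.
have phiM x : `|phi x| <= 1 by have /andP[? ?] := phi01 x; rewrite ger0_norm.
have c1 : \int[muk k 0]_x phi x @[k --> \oo] --> \int[mu 0]_x phi x.
  apply: (muk_cvg cphi phiM) => // e e0.
  by exists c => // x y; rewrite (le_trans (phic x y))// lerDr ltW.
have E : (fun k => \int[muk k 0]_x phi x) = cst (\int[mubar]_x phi x).
  apply/funext => k; exact: (Rintegral_measure_eq _ (sol_muk k).1).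
rewrite E in c1.
exact: (cvg_unique (@Rhausdorff R) c1 (cvg_cst _)).
Qed.

(** Along the chain mu s, muk j s, m N s, m N t, muk j t, mu t consecutive
    measures are at W1-distance less than d, with j and N chosen before k; the
    middle link may need one more measure m N p, when a grid time p separates s
    from t. This makes at most six links, whence e / 6. *)
Lemma mean_flux_equicontinuous g (T e : R) : test_function g -> 0 < T -> 0 < e ->
  exists2 r, 0 < r & forall k s t, 0 <= s <= T -> 0 <= t <= T -> `|s - t| < r ->
    `|H g k (mu s) - H g k (mu t)| <= e.
Proof.
move=> tg T0 e0; have e60 : 0 < e / 6 by rewrite divr_gt0.
have [d d0 Hd] := mean_flux_modulus compactU hf control_u lip_u tg e60.
have [j Hj] := filter_ex (muk_near_mu d0).
have [m [Lm cm]] := LAS_muk j T0.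
have [N [N0 [LN HN]]] : exists N, (0 < N)%N /\
    is_LAS (control_field hf (u j)) mubar N T (m N) /\
    forall t, t \in `[0, T] -> (W1 (m N t) (muk j t) < d%:E)%E.
  have Hm := W1_sup_near (a := m) (b := fun _ => muk j) cm d0.
  have [N [[N0 LN] HN]] := filter_ex (filterI (filterI (nbhs_infty_gt 0) Lm) Hm).
  by exists N.
have NR0 : 0 < N%:R :> R by rewrite ltr0n.
pose B : R := n%:R * N%:R.
have B0 : 0 <= B by rewrite mulr_ge0.
have Br : 0 < d / (B + 1) by rewrite divr_gt0//; lra.
exists (Num.min N%:R^-1 (d / (B + 1))); first by rewrite lt_min invr_gt0 NR0 Br.
(* Within one time step the atoms move with speed at most B. *)
have step l s t : l%:R / N%:R <= s <= l.+1%:R / N%:R -> s <= T ->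
    l%:R / N%:R <= t <= l.+1%:R / N%:R -> t <= T -> `|s - t| < d / (B + 1) ->
    [/\ compactly_supported (m N s), compactly_supported (m N t) &
     (W1 (m N s) (m N t) < d%:E)%E].
  move=> ls sT lt tT st.
  have [c1 c2 W] := LAS_step_W1 N0 (LN.2 l s ls sT) (LN.2 l t lt tT).
  split => //; apply: (le_lt_trans W); rewrite lte_fin -/B.
  rewrite (_ : s - _ - _ = s - t); last by ring.
  rewrite (@le_lt_trans _ _ (B * (d / (B + 1))))// ?ler_wpM2l ?(ltW st)//.
  by rewrite mulrCA gtr_pMr// ltr_pdivrMr; lra.
have grid (t : R) : 0 <= t -> exists l : nat, l%:R / N%:R <= t < l.+1%:R / N%:R.
  move=> t0; exists (Num.Def.trunc (t * N%:R)).
  rewrite ler_pdivrMr// ltr_pdivlMr//; apply: truncn_itv.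
  by rewrite mulr_ge0.
have near_m k t : 0 <= t -> t <= T -> `|H g k (mu t) - H g k (m N t)| <= e / 6 + e / 6.
  move=> t0 tT; have [l lt] := grid t t0.
  have lt' : l%:R / N%:R <= t <= l.+1%:R / N%:R by case/andP: lt => -> /ltW.
  have tt : `|t - t| < d / (B + 1) by rewrite subrr normr0.
  have [cs _ _] := step l t t lt' tT lt' tT tt.
  have cj := @muk_compactly_supported j t t0.
  have h1 := Hd k _ _ cj (mu_compactly_supported t0) (Hj t t0).
  have h2 := Hd k _ _ cs cj (HN t _).
  have -> : H g k (mu t) - H g k (m N t) = - (H g k (m N t) - H g k (muk j t))
    - (H g k (muk j t) - H g k (mu t)) by ring.
  rewrite (le_trans (ler_normB _ _))// normrN lerD//.
  by apply: h2; rewrite in_itv/= t0.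
have dist3 (a b x y : R) c : `|a - x| <= e / 6 + e / 6 -> `|b - y| <= e / 6 + e / 6 ->
    `|x - c| <= e / 6 -> `|c - y| <= e / 6 -> `|a - b| <= e.
  rewrite !ler_norml => /andP[? ?] /andP[? ?] /andP[? ?] /andP[? ?].
  by apply/andP; split; lra.
move=> k s t; wlog st : s t / s <= t.
  move=> W hs ht; rewrite distrC (distrC (H _ _ _)).
  by have [st|/ltW st] := leP s t; [rewrite distrC (distrC (H _ _ _))|]; exact: W.
move=> /andP[s0 sT] /andP[t0 tT]; rewrite lt_min => /andP[stN std].
have ns := near_m k s s0 sT; have nt := near_m k t t0 tT.
have [l /andP[lt tl]] := grid t t0.
rewrite distrC ger0_norm ?subr_ge0// in stN.
(* Here t - s < 1/N, so that at most one grid time lies between s and t. *)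
have [ls|sl] := leP (l%:R / N%:R) s.
  have ls' : l%:R / N%:R <= s <= l.+1%:R / N%:R by rewrite ls (le_trans st (ltW tl)).
  have lt' : l%:R / N%:R <= t <= l.+1%:R / N%:R by rewrite lt ltW.
  have [c1 c2 W] := step l s t ls' sT lt' tT std.
  apply: (dist3 _ _ _ _ _ ns nt _ (Hd k _ _ c1 c2 W)).
  by rewrite subrr normr0 ltW.
case: l lt tl sl => [|l] lt tl sl; first by move: sl; rewrite mul0r ltNge s0.
pose p : R := l.+1%:R / N%:R.
have pT : p <= T by exact: le_trans lt tT.
have lp : l%:R / N%:R <= p by rewrite /p ler_pM2r ?invr_gt0// ler_nat.
have ls : l%:R / N%:R <= s.
  move: lt; rewrite -natr1 mulrDl mul1r; lra.
have pl : l.+1%:R / N%:R <= p <= l.+2%:R / N%:R.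
  by rewrite lexx/= ler_pM2r ?invr_gt0// ler_nat.
have [sp pt] : `|s - p| < d / (B + 1) /\ `|p - t| < d / (B + 1).
  have sp0 : s <= p := ltW sl; have pt0 : p <= t := lt.
  split; apply: le_lt_trans std; rewrite !ler0_norm ?subr_le0// !opprB.
    by rewrite lerD2r.
  by rewrite lerD2l lerN2.
have ls' : l%:R / N%:R <= s <= l.+1%:R / N%:R by rewrite ls ltW.
have lp' : l%:R / N%:R <= p <= l.+1%:R / N%:R by rewrite lp lexx.
have lt' : l.+1%:R / N%:R <= t <= l.+2%:R / N%:R by rewrite lt ltW.
have [c1 c2 W] := step l s p ls' sT lp' pT sp.
have [c3 c4 W'] := step l.+1 p t pl pT lt' tT pt.
exact: (dist3 _ _ _ _ _ ns nt (Hd k _ _ c1 c2 W) (Hd k _ _ c3 c4 W')).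
Qed.

Lemma mean_flux_muk_near g e : test_function g -> 0 < e ->
  \forall k \near \oo, forall t, 0 <= t ->
    `|H g k (muk k t) - H g k (mu t)| <= e.
Proof.
move=> tg e0; have [d d0 Hd] := mean_flux_modulus compactU hf control_u lip_u tg e0.
apply: filterS (muk_near_mu d0) => k Hk t t0; apply: Hd (Hk t t0).
- exact: muk_compactly_supported.
- exact: mu_compactly_supported.
Qed.

Lemma muk_slope g k (c e a b : R) : test_function g -> 0 <= a -> a <= b ->
  (forall t, a <= t <= b -> `|H g k (muk k t) - c| <= e) ->
  `|\int[muk k b]_x g x - \int[muk k a]_x g x - c * (b - a)| <= e * (b - a).
Proof.
move=> tg a0 ab Hc; have b1 : 0 < b + 1 by lra.
have [_ _ AC D] := (sol_muk k).2 _ b1 g tg.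
apply: (abs_continuous_slope AC D a0 ab _) => [|t tab]; first by rewrite lerDl.
by rewrite control_field_integral//; exact: Hc.
Qed.

Context (F : set_system nat) {UF : UltraFilter F} (Foo : \oo `<=` F).

(** A genuine limit when g is a test function, since its fluxes are bounded. *)
Definition limit_flux g (m : 'P[R] X) : R := lim (mean_flux fhat u g k m @[k --> F]).

Lemma limit_flux_cvg g m : test_function g -> H g k m @[k --> F] --> limit_flux g m.
Proof.
move=> tg; have [M _ HM] := mean_flux_bound compactU hf u tg.
by apply: (ultra_bounded_cvg (M := M)) => k; exact: HM.
Qed.

Let I_cvg g t : test_function g -> 0 <= t ->
  \int[muk k t]_x g x @[k --> F] --> \int[mu t]_x g x.
Proof.
move=> tg t0; have [M _ HM] := test_function_bound tg.
have := muk_cvg (test_function_continuous tg) HM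
  (fun e => @test_function_modulus _ _ g e tg) t0.
by apply: cvg_trans => A /Foo.
Qed.

(** The slope bounds for the curves muk pass to the limit: the integrals of g
    converge and the reference slopes c k converge along F. *)
Lemma limit_slope g (c : nat -> R) (l e a b : R) : test_function g -> 0 <= a -> a <= b ->
  c @ F --> l ->
  (\forall k \near \oo, forall t, a <= t <= b -> `|H g k (muk k t) - c k| <= e) ->
  `|\int[mu b]_x g x - \int[mu a]_x g x - l * (b - a)| <= e * (b - a).
Proof.
move=> tg a0 ab cl Hc.
have Hk : \forall k \near F,
    `|\int[muk k b]_x g x - \int[muk k a]_x g x - c k * (b - a)| <= e * (b - a).
  by apply: Foo; apply: filterS Hc => k; exact: muk_slope.
apply: (cvg_norm_le Hk); apply: cvgB.
  by apply: cvgB; apply: I_cvg => //; exact: le_trans ab.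
by apply: cvgMr_tmp.
Qed.

(** On a neighbourhood of t independent of k, the fluxes along muk k stay within
    e of H g k (mu t): e/2 for replacing muk k s by mu s, e/2 for moving from s
    to t. *)
Lemma limit_curve_derivative g (t : R) : test_function g -> 0 < t ->
  is_derive t 1 (fun s => \int[mu s]_x g x) (limit_flux g (mu t)).
Proof.
move=> tg t0; apply/is_deriveP => e e0.
have e20 : 0 < e / 2 by rewrite divr_gt0.
have T0 : 0 < t + 1 by lra.
have [r r0 Hr] := mean_flux_equicontinuous tg T0 e20.
have slope a b : 0 <= a -> a <= b -> a <= t <= b -> b <= t + 1 ->
    b < t + r -> t - r < a ->
    `|\int[mu b]_x g x - \int[mu a]_x g x - limit_flux g (mu t) * (b - a)| <= e * (b - a).
  move=> a0 ab /andP[at_ tb] bt br ar.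
  apply: (limit_slope tg a0 ab (@limit_flux_cvg g (mu t) tg)).
  apply: filterS (mean_flux_muk_near tg e20) => k Hk s /andP[as_ sb].
  have -> : H g k (muk k s) - H g k (mu t) =
    (H g k (muk k s) - H g k (mu s)) + (H g k (mu s) - H g k (mu t)) by rewrite addrA subrK.
  rewrite (le_trans (ler_normD _ _))// [leRHS](splitr e) lerD//.
    by apply: Hk; exact: le_trans as_.
  by apply: Hr; rewrite ?ltr_norml; apply/andP; split; lra.
exists (Num.min (Num.min r t) 1); first by rewrite !lt_min r0 t0 ltr01.
move=> y; rewrite !lt_min => /andP[/andP[yr yt] y1].
move: yr yt y1; rewrite !ltr_norml => /andP[? ?] /andP[? ?] /andP[? ?].
have [ty|yt] := leP t y.
  rewrite (ger0_norm (_ : 0 <= y - t)) ?subr_ge0//.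
  by apply: slope; rewrite ?lexx ?ty//; lra.
rewrite (ltr0_norm (_ : y - t < 0)) ?subr_lt0// opprB -normrN.
have -> : - (\int[mu y]_x g x - \int[mu t]_x g x - limit_flux g (mu t) * (y - t)) =
  \int[mu t]_x g x - \int[mu y]_x g x - limit_flux g (mu t) * (t - y) by ring.
by apply: slope; rewrite ?lexx ?andbT ?(ltW yt)//; lra.
Qed.

Lemma limit_curve_Lipschitz g : test_function g -> exists2 M, 0 <= M &
  forall a b, 0 <= a -> a <= b ->
    `|\int[mu b]_x g x - \int[mu a]_x g x| <= M * (b - a).
Proof.
move=> tg; have [M M0 HM] := mean_flux_bound compactU hf u tg.
exists M => // a b a0 ab.
have c0 : (fun _ : nat => 0 : R) @ F --> (0 : R) by exact: cvg_cst.
have := limit_slope (e := M) tg a0 ab c0; rewrite mul0r subr0; apply.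
by apply: nearW => k t _; rewrite subr0; exact: HM.
Qed.

Lemma limit_flux_within_continuous g T : test_function g -> 0 < T ->
  {within `[0, T], continuous (fun s => limit_flux g (mu s))}.
Proof.
move=> tg T0; apply/subspace_continuousP => t; rewrite /= in_itv/= => tT.
apply/cvgrPdist_le => e e0.
have [r r0 Hr] := mean_flux_equicontinuous tg T0 e0.
rewrite near_withinE; apply/nbhs_ballP; exists r => //= s.
rewrite -ball_normE /= => ts; rewrite in_itv/= => sT.
have /cvg_norm_le : \forall k \near F, `|H g k (mu t) - H g k (mu s)| <= e.
  by apply: (@filterE _ F) => k; exact: Hr.
by apply; apply: cvgB; exact: limit_flux_cvg.
Qed.

Lemma limit_curve_solution (V : 'P[R] X -> 'P[R] (X * X)) :
  (forall t, 0 <= t -> forall g, test_function g ->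
    (V (mu t)).-integrable setT (EFin \o transport_integrand g) /\
    \int[V (mu t)]_z transport_integrand g z = limit_flux g (mu t)) ->
  solution V mubar mu.
Proof.
move=> HV; split; first exact: mu_initial.
have aeL (P : R -> Prop) : (forall s, P s) ->
    {ae (lebesgue_measure : set R -> \bar R), forall s, P s}.
  exact: (@aeW _ _ _ (@lebesgue_measure R)).
move=> T T0 g tg; split.
- apply: aeL => s; rewrite in_itv/= => /andP[s0 _].
  by have [] := HV s s0 g tg.
- exists (fun s => limit_flux g (mu s)).
    have [M _ HM] := mean_flux_bound compactU hf u tg.
    apply: (continuous_lebesgue_integrable (M := M)).
      exact: limit_flux_within_continuous.
    move=> s _; apply: cvg_norm_le (limit_flux_cvg (m := mu s) tg).
    by apply: (@filterE _ F) => k; exact: HM.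
  apply: aeL => s; rewrite in_itv/= => /andP[s0 _].
  by have [] := HV s s0 g tg.
- move=> e e0; have [M M0 HM] := limit_curve_Lipschitz tg.
  exists (e / (M + 1)); first by rewrite divr_gt0//; lra.
  move=> m s t st _ Hst.
  apply: (@le_lt_trans _ _ (M * \sum_i (t i - s i))).
    rewrite mulr_sumr; apply: ler_sum => i _; have [s0 [st' tT]] := st i.
    exact: HM.
  apply: (@le_lt_trans _ _ (M * (e / (M + 1)))); first by rewrite ler_wpM2l// ltW.
  by rewrite mulrCA gtr_pMr// ltr_pdivrMr; lra.
(* The time 0 is excluded because a derivative there would involve the values
   of the curve at negative times. *)
- exists [set 0]; split => //; first exact: lebesgue_measure_set1.
  move=> t nt; apply: contrapT => t0; apply: nt; rewrite /= in_itv/= => /andP[t0' tT].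
  have t00 : 0 < t by rewrite lt_neqAle t0' andbT; apply/eqP => /esym.
  have [_ ->] := HV t t0' g tg.
  exact: limit_curve_derivative.
Qed.

End LimitCurve.

Theorem theorem7 (R : realType) (n : nat)
    (Y : metricType R) (polishY : polish Y)
    (U : set Y) (u0 : U) (compactU : compact U)
    (fhat : 'rV[R]_n * ctrl u0 -> 'rV[R]_n) (hf : dynamics_Lipschitz fhat)
    (mubar : 'P[R] 'rV[R]_n) (mubar_c : compactly_supported mubar)
    (K : set 'rV[R]_n) (compactK : compact K) (mubarK : spt mubar `<=` K)
    (u : nat -> 'P[R] 'rV[R]_n -> 'P[R] ('rV[R]_n * ctrl u0))
    (control_u : forall k, measure_control (u k))
    (lip_u : uniformly_W_Lipschitz u)
    (muk : nat -> R -> 'P[R] 'rV[R]_n)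
    (sol_muk : forall k, solution (control_field hf (u k)) mubar (muk k))
    (LAS_muk : forall k, limit_of_LAS (control_field hf (u k)) mubar (muk k))
    (muk_K : forall k t, 0 <= t -> spt (muk k t) `<=` K)
    (mu : R -> 'P[R] 'rV[R]_n)
    (cvg_mu : ereal_sup [set W1 (muk k t) (mu t) | t in [set t | 0 <= t]]
                @[k --> \oo] --> 0%E) :
  exists V : 'P[R] 'rV[R]_n -> 'P[R] ('rV[R]_n * 'rV[R]_n),
    measure_vector_field V /\ solution V mubar mu.
Proof.
have [F [UF Foo]] := @ultraFilterLemma nat \oo _.
have field_ex (m : 'P[R] 'rV[R]_n) :
  exists nu : 'P[R] ('rV[R]_n * 'rV[R]_n), marginal1 nu ≡μ m /\
   (m (~` K) = 0%E -> forall g, test_function g ->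
    nu.-integrable setT (EFin \o transport_integrand g) /\
    \int[nu]_z transport_integrand g z = limit_flux fhat u F g m).
  have [mK|mK] := pselect (m (~` K) = 0%E).
    have [nu [nu1 Hnu]] := barycentric_field compactU hf control_u compactK (F := F) mK.
    exists nu; split => // _ g tg; have [ig cg] := Hnu g tg; split => //.
    exact/esym/cvg_lim.
  exists (control_field hf (u 0%N) m); split => // A mA.
  exact: (control_u 0%N).2.
have rep_ex (m : 'P[R] 'rV[R]_n) : exists m' : 'P[R] 'rV[R]_n, m' ≡μ m by exists m.
(* A vector field must respect equality on measurable sets. It is therefore
   defined through one representative of each class of measures: the classes of
   m1 and m2 are equal predicates when m1 and m2 agree on measurable sets. *)
pose rep m := sval (cid (rep_ex m)).
have repE m : rep m ≡μ m by rewrite /rep; case: cid.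
have rep_eq (m1 m2 : 'P[R] 'rV[R]_n) : m1 ≡μ m2 -> rep m1 = rep m2.
  move=> m12; rewrite /rep.
  have E : (fun m' : 'P[R] 'rV[R]_n => m' ≡μ m1) =
      (fun m' : 'P[R] 'rV[R]_n => m' ≡μ m2).
    apply/funext => m'; apply/propext; split => h A mA; first by rewrite h// m12.
    by rewrite h// m12.
  move: (rep_ex m1) (rep_ex m2); rewrite E => e1 e2.
  by rewrite (Prop_irrelevance e1 e2).
pose V m := sval (cid (field_ex (rep m))).
exists V; split.
  split; first by move=> m1 m2 m12; rewrite /V (rep_eq _ _ m12).
  move=> m A mA; rewrite /V; case: cid => nu [/= nu1 _].
  by rewrite nu1// repE.
apply: (limit_curve_solution compactU compactK control_u lip_u sol_muk LAS_muk
  muk_K cvg_mu Foo).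
move=> t t0 g tg; rewrite /V; case: cid => nu [/= nu1 Hnu].
have -> : limit_flux fhat u F g (mu t) = limit_flux fhat u F g (rep (mu t)).
  rewrite /limit_flux; congr (lim (_ @ F)); apply/funext => k.
  by apply: mean_flux_measure_eq => // A mA; rewrite repE.
apply: Hnu => //; rewrite repE; last first.
  apply: open_borel_measurable; apply: closed_openC.
  by apply: compact_closed compactK; exact: norm_hausdorff.
exact: (mu_off_K compactK muk_K cvg_mu).
Qed.
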